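(* Assume condition (N), $\chi(0)<0$, $g(s,\tau)\leq g'(0,\tau)s$ for all $s\geq0$, $\tau\in X$, and condition (L) with constant $\delta>0$. Suppose $\chi$ is defined on an open interval $(0,\bar\omega)$ and changes sign there; let $\lambda$ be the leftmost positive zero of $\chi$, and let $\epsilon>0$ with $\nu=\lambda+\epsilon<\bar\omega$ and $\chi(\nu)>0$. Then $\mathcal A$ has at least one fixed point $\phi\in\mathfrak K$. If $G'(0)$ is a finite number, then $|\phi|_\infty:=\sup_{s\in\mathbb{R}}\phi(s)$ is finite and $|\phi|_\infty<\zeta_2$. Moreover, if the equation $G(s)=s$ has exactly two solutions $0$ and $\kappa$ on $[0,\infty)$ and $\kappa$ is globally attracting with respect to the map $G:(0,\zeta_2]\to(0,\zeta_2]$, then $\lim_{t\to+\infty}\phi(t)=\kappa$.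
   Context: Let $(X,\mu)$ be a finite measure space. Let $K:\mathbb{R}\times X\to[0,\infty)$ be measurable and integrable on $\mathbb{R}\times X$, with $\int_{\mathbb{R}}K(s,\tau)\,ds>0$ for every $\tau$. Let $g:[0,\infty)\times X\to[0,\infty)$ be measurable, with $g(0,\tau)=0$, $g(\cdot,\tau)$ continuous for each $\tau$, and the derivative $g'(0,\tau)$ at $0$ existing and positive. $\chi(z)=1-\int_X\int_{\mathbb{R}}K(s,\tau)g'(0,\tau)e^{-sz}\,ds\,d\mu(\tau)$ where the integral converges. Condition (N): (N1) there is $\tau_0\in X$ with $\mu(\{\tau_0\})=1$ such that $g(v,\tau)$ is increasing in $v$ for each $\tau\neq\tau_0$ and $g(v,\tau_0)>0$ for $v>0$; $\tilde g(v)=\int_{X\setminus\{\tau_0\}}g(v,\tau)\left(\int_{\mathbb{R}}K(s,\tau)ds\right)d\mu(\tau)$. (N2) there is $\zeta_2>0$ such that $\Theta(v)=v-\tilde g(v)$ is strictly increasing on $[0,\zeta_2]$ and $\Theta(\zeta_2)>C\max_{v\geq0}g(v,\tau_0)$, $C=\int_{\mathbb{R}}K(s,\tau_0)ds$. $G(v)=\Theta^{-1}(Cg(v,\tau_0))$, $v\geq0$, with $\Theta^{-1}$ the inverse of $\Theta|_{[0,\zeta_2]}$. ''$\kappa$ globally attracting'' means $G^n(s)\to\kappa$ for every $s\in(0,\zeta_2]$. Condition (L): $g$ is bounded, $g(s,\tau)>0$ for $s>0$, and $g(s,\tau)=g'(0,\tau)s$ for all $s\in[0,\delta)$, $\tau\in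 X$. $\mathfrak X=\{\varphi\in C(\mathbb{R},\mathbb{R}):\sup_{s\leq0}e^{-0.5\lambda s}|\varphi(s)|+\sup_{s\geq0}e^{-\nu s}|\varphi(s)|<+\infty\}$; $\phi^+(t)=\delta e^{\lambda t}$; $\phi^-(t)=\delta e^{\lambda t}(1-e^{\epsilon t})$ for $t\leq0$, $\phi^-(t)=0$ for $t>0$; $\mathfrak K=\{\varphi\in\mathfrak X:\phi^-\leq\varphi\leq\phi^+\}$; $\mathcal A\varphi(t)=\int_X d\mu(\tau)\int_{\mathbb{R}}K(s,\tau)g(\varphi(t-s),\tau)\,ds$. *)

(* Defs.v *)
From HB Require Import structures.
From mathcomp Require Import all_boot all_order all_algebra.
From mathcomp Require Import all_classical all_reals all_analysis.
Import Order.TTheory GRing.Theory Num.Theory.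
Import numFieldNormedType.Exports.
Local Open Scope classical_set_scope.
Local Open Scope ring_scope.

Section Defs.
Context {R : realType} {d : measure_display} {X : measurableType d}.
Variables (mu : set X -> \bar R) (K : R -> X -> R).

(* the double integral  int_X int_R K(s,tau) g'(0,tau) e^{-s z} ds dmu(tau)
   (nonnegative integrand, so it is a well-defined element of [0,+oo]) *)
Definition chi_integral (gp : X -> R) (z : R) : \bar R :=
  (\int[mu]_tau \int[lebesgue_measure]_s (K s tau * gp tau * expR (- (s * z)))%:E)%E.

Definition chi_defined (gp : X -> R) (z : R) : Prop := (chi_integral gp z < +oo)%E.

Definition chi (gp : X -> R) (z : R) : R := 1 - fine (chi_integral gp z).

Definition Kmass (tau : X) : \bar R := (\int[lebesgue_measure]_s (K s tau)%:E)%E.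

Definition gtilde (g : R -> X -> R) (tau0 : X) (v : R) : R :=
  fine (\int[mu]_(tau in ~` [set tau0]) ((g v tau)%:E * Kmass tau))%E.

Definition Theta (g : R -> X -> R) (tau0 : X) (v : R) : R := v - gtilde g tau0 v.

(* G(v) = Theta^{-1}(C g(v,tau0)), Theta^{-1} the inverse of Theta restricted to
   [0, zeta2], C = int_R K(s,tau0) ds *)
Definition Gmap (g : R -> X -> R) (tau0 : X) (zeta2 : R) (v : R) : R :=
  xget 0 [set w | 0 <= w <= zeta2 /\
                  Theta g tau0 w = fine (Kmass tau0) * g v tau0].
End Defs.

Definition frakX {R : realType} (lambda nu : R) (phi : R -> R) : Prop :=
  continuous phi /\
  exists M : R, forall s : R,
    (s <= 0 -> expR (- (lambda / 2 * s)) * `|phi s| <= M) /\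
    (0 <= s -> expR (- (nu * s)) * `|phi s| <= M).

Definition phi_plus {R : realType} (delta lambda : R) (t : R) : R :=
  delta * expR (lambda * t).

Definition phi_minus {R : realType} (delta lambda eps : R) (t : R) : R :=
  if t <= 0 then delta * expR (lambda * t) * (1 - expR (eps * t)) else 0.

Definition frakK {R : realType} (delta lambda eps nu : R) (phi : R -> R) : Prop :=
  frakX lambda nu phi /\
  forall t, phi_minus delta lambda eps t <= phi t <= phi_plus delta lambda t.

Definition Aop {R : realType} {d : measure_display} {X : measurableType d}
  (mu : set X -> \bar R) (K : R -> X -> R) (g : R -> X -> R) (phi : R -> R) (t : R)
  : \bar R :=
  (\int[mu]_tau \int[lebesgue_measure]_s (K s tau * g (phi (t - s)) tau)%:E)%E.

(* Main.v *)
Require Import Defs.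
From HB Require Import structures.
From mathcomp Require Import all_boot all_order all_algebra.
From mathcomp Require Import fingroup perm.
From mathcomp Require Import all_classical all_reals all_analysis.
From mathcomp Require Import measurable_realfun zify ring lra.
Import Order.TTheory GRing.Theory Num.Theory.
Import numFieldNormedType.Exports.
Local Open Scope classical_set_scope.
Local Open Scope ring_scope.

(** Since chi(0) < 0 forces delta <= zeta2, g may be replaced by its truncation
    v |-> g(min(v, zeta2)); the truncated operator maps everything below
    gtilde(zeta2) + C sup g(., tau0) < zeta2, so its fixed points are fixed points
    of A lying below zeta2.  The fixed point is sought between phi^+ and the
    maximum of phi^- and of the running supremum of theta phi^-, for a small
    theta: translates of phi^- are subsolutions as well, so this smaller interval
    is still invariant, and it gives a positive lower bound near +oo.  Schauder's
    theorem on it is obtained from Brouwer's theorem for step functions (proved by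
    a cochain version of Kuhn's lemma) and from the L1-continuity of translations,
    which makes the image of A equicontinuous.

    If m and S are the limits inferior and superior of phi at +oo, limits of
    translates of phi are fixed points with values in [m, S] attaining m or S at
    0.  Comparing both sides of the equation at 0 shows that G maps points of
    [m, S] below m and above S, and a globally attracting interval map can do so
    only if m = S = kappa. *)

(** * Kuhn's lemma *)

(** This is why a Schauder argument is used, and why the final comparison takes extreme values of
    [g] at [tau0] over [m, S] but plain monotonicity at all other points; solving the resulting
    inequalities for [Theta] is what produces [G]. [K] is merely integrable, so regularity comes
    from the substitution s -> t - s, which leaves t in the kernel alone: the modulus of continuity
    of A phi depends on [K] and on a bound for [g], never on phi. Hence functions that are only
    measurable, such as step functions, are admissible arguments, and by domination pointwise
    convergence is enough for the continuity of A. Exponentials e^(z t) are eigenfunctions of the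
    linearised operator with eigenvalue 1 - chi(z). The eigenvalue is 1 at [lambda], which makes
    phi^+ a supersolution, and below 1 at [lambda + eps], which makes phi^- a subsolution. The
    inequality delta <= zeta2 keeps the truncation away from the range where [g] is linear. *)

Section Kuhn.
Variables M n : nat.
Local Notation N := M.+1.
Implicit Types (z : {ffun 'I_N -> 'I_n.+1}) (r : 'S_N) (x : 'I_N -> nat).

(** Freudenthal triangulation: [r j] is the step at which coordinate [j] is raised, so each
    permutation gives one monotone path of vertices across the cube with lowest corner [z]. *)
Definition kuhn_vertex z r (k : nat) : 'I_N -> nat :=
  fun j => (z j + (r j < k))%N.

(** This is the mod 2 cup product of the coboundaries of the [f i], evaluated on the sum of all
    simplices. If it is nonzero, some simplex has, for every [i], a change of [f i] along its [i]-th
    edge. *)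
Definition kuhn_degree (f : 'I_N -> ('I_N -> nat) -> 'F_2) : 'F_2 :=
  \sum_r \sum_z \prod_(i < N)
    (f i (kuhn_vertex z r i.+1) - f i (kuhn_vertex z r i)).

(** Such sums appear when one coboundary factor of the degree is expanded: [bump j] skips the edge
    [j] that this factor occupied, and [q] is the end of the edge at which the expanded function is
    read. *)
Definition gap_sum (h : ('I_N -> nat) -> 'F_2) (c : 'I_M -> ('I_N -> nat) -> 'F_2)
    (q j : nat) : 'F_2 :=
  \sum_r \sum_z h (kuhn_vertex z r q) * \prod_(i < M)
    (c i (kuhn_vertex z r (bump j i).+1) - c i (kuhn_vertex z r (bump j i))).

Lemma addF2 (a : 'F_2) : a + a = 0.
Proof. by rewrite -mulr2n -mulr_natl pchar_Zp ?mul0r. Qed.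

Lemma oppF2 (a : 'F_2) : - a = a.
Proof. by apply/eqP; rewrite eq_sym -subr_eq0 opprK addF2. Qed.

(** Multiplication by a transposition exchanges even and odd permutations, so equal terms pair off
    and cancel mod 2. *)
Lemma sum_perm_invol (F : 'S_N -> 'F_2) (a b : 'I_N) : a != b ->
  (forall r, F (r * tperm a b)%g = F r) -> \sum_r F r = 0.
Proof.
move=> ab Fab; rewrite (bigID (fun r : 'S_N => odd_perm r)) /=.
rewrite [X in _ + X](reindex_inj (mulIg (tperm a b))) /=.
rewrite [X in _ + X](eq_big (fun r : 'S_N => odd_perm r) F); first by rewrite addF2.
  by move=> r; rewrite odd_permM odd_tperm ab addbT negbK.
by move=> r _; exact: Fab.
Qed.

(** Exchanging two consecutive steps of a path changes only the vertex between them. *)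
Lemma kuhn_vertex_tperm z r (a b : 'I_N) (k : nat) : b = a.+1 :> nat -> k != b ->
  kuhn_vertex z (r * tperm a b)%g k = kuhn_vertex z r k.
Proof.
move=> ba kb; apply/funext => j; rewrite /kuhn_vertex permM; congr (_ + nat_of_bool _)%N.
by case: tpermP => [->|->|//]; lia.
Qed.

(* Shifting the omitted edge from [j] to [j.+1] changes a sum of products in
   which the vertex [j.+1] no longer occurs; transposing the two steps around
   this vertex pairs off the terms of that sum. *)
Lemma gap_sum_move h c q j : (j < M)%N -> q != j.+1 ->
  gap_sum h c q j = gap_sum h c q j.+1.
Proof.
move=> jM qj; apply/eqP; rewrite -subr_eq0 oppF2 /gap_sum -big_split /=; apply/eqP.
have jN : (j < N)%N by lia.
pose a := Ordinal jN; pose b : 'I_N := Ordinal (jM : (j.+1 < N)%N).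
apply: (@sum_perm_invol _ a b).
  by apply/eqP => /(congr1 val) /=; lia.
move=> r; rewrite -!big_split /=; apply: eq_bigr => z _.
rewrite -!mulrDr (kuhn_vertex_tperm z r a b _ (erefl : b = a.+1 :> nat)) //.
congr (_ * _); pose i0 := Ordinal jM.
have split_at (s : 'S_N) :
    \prod_(i < M) (c i (kuhn_vertex z s (bump j i).+1) - c i (kuhn_vertex z s (bump j i)))
  + \prod_(i < M) (c i (kuhn_vertex z s (bump j.+1 i).+1) - c i (kuhn_vertex z s (bump j.+1 i)))
  = (c i0 (kuhn_vertex z s j.+2) - c i0 (kuhn_vertex z s j)) *
    \prod_(i < M | i != i0) (c i (kuhn_vertex z s (bump j i).+1) - c i (kuhn_vertex z s (bump j i))).
  rewrite (bigD1 i0) //= [X in _ + X](bigD1 i0) //=.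
  rewrite [X in _ + _ * X](eq_bigr (fun i : 'I_M =>
     c i (kuhn_vertex z s (bump j i).+1) - c i (kuhn_vertex z s (bump j i)))); last first.
    move=> i ii0; have : (i : nat) != j by apply: contra ii0 => /eqP ij; apply/eqP/val_inj.
    move=> ij; suff -> : bump j.+1 i = bump j i by [].
    by rewrite /bump; lia.
  rewrite -mulrDl; congr (_ * _).
  have -> : bump j j = j.+1 by rewrite /bump; lia.
  have -> : bump j.+1 j = j by rewrite /bump; lia.
  by rewrite addrA subrK.
rewrite !split_at; congr (_ * _).
  by rewrite !(kuhn_vertex_tperm z r a b _ (erefl : b = a.+1 :> nat)) //=; lia.
apply: eq_bigr => i ii0.
have ij : (i : nat) != j by apply: contra ii0 => /eqP ij; apply/eqP/val_inj.
by rewrite !(kuhn_vertex_tperm z r a b _ (erefl : b = a.+1 :> nat)) //= /bump; lia.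
Qed.

(** The face opposite the first vertex also belongs to the neighbouring cube in the direction of the
    first step. There it lies opposite the last vertex of the simplex whose permutation is rotated
    by one. The change of variables is this passage, taken cyclically in [z] so that it is a
    bijection. *)
Lemma gap_sum_rot h c (p : 'I_N) :
  (forall x, x p = 0%N -> h x = 0) -> (forall x, x p = n.+1 -> h x = 0) ->
  (forall i x, x (lift p i) = 0%N -> c i x = 0) ->
  (forall i x, x (lift p i) = n.+1 -> c i x = 1) ->
  gap_sum h c p.+1 0 = gap_sum h c p M.
Proof.
move=> h0 h1 c0 c1; rewrite /gap_sum.
rewrite [RHS](reindex_inj (mulIg (perm (@addIr _ (- inZp 1 : 'I_N))))) /=.
apply: eq_bigr => r _; set s := (r * _)%g.
rewrite [RHS](reindex_inj (addIr [ffun j => inZp (r j == 0)])) /=.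
apply: eq_bigr => z _; set z' := z + _.
have sE j : (s j : nat) = if r j == 0 then M else (r j).-1.
  rewrite permM permE; case: ifPn => [/eqP ->|].
    by rewrite add0r /=; case: (M) => [|m] //=; rewrite ?modn_small //; lia.
  move=> rj; have rj0 : (0 < r j)%N by rewrite lt0n; apply: contra rj => /eqP e; apply/eqP/val_inj.
  have := ltn_ord (r j).
  move: rj0; case: (r j) => k /= kl k0 kl'. 
  have M0 : (0 < M)%N by lia.
  have -> : (1 %% M.+1 = 1)%N by rewrite modn_small //; lia.
  rewrite subn1 /= (@modn_small M) //.
  by rewrite (_ : k + M = k.-1 + M.+1)%N ?modnDr ?modn_small //; lia.
pose j0 := (r^-1)%g 0; have rj0 : r j0 = 0 by rewrite /j0 permKV.
have rj j : (r j == 0) = (j == j0) by rewrite -rj0 (inj_eq perm_inj).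
have z'E j : j != j0 -> z' j = z j.
  move=> jj; rewrite !ffunE rj (negbTE jj) (_ : inZp false = 0) ?addr0 //.
  by apply: val_inj; rewrite /= mod0n.
have z'0 : (z' j0 : nat) = if (z j0 < n)%N then (z j0).+1 else 0.
  rewrite !ffunE rj eqxx /=; have := ltn_ord (z j0); case: (z j0) => k kl /= _.
  case: ifPn => kn; first by rewrite [(1 %% _)%N]modn_small ?modn_small; lia.
  have -> : k = n by lia.
  case: (n) => [|m] //.
  by rewrite [(1 %% _)%N]modn_small ?addn1 ?modnn.
have [zj|zj] := ltnP (z j0) n.
  have vE k : (k <= M)%N -> kuhn_vertex z' s k = kuhn_vertex z r k.+1.
    move=> kM; apply/funext => j; rewrite /kuhn_vertex sE rj.
    have [->|jj0] := eqVneq j j0; first by rewrite z'0 zj rj0 /=; lia.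
    rewrite z'E //; have : (r j : nat) != 0 by apply: contra jj0 => /eqP e; rewrite -rj; apply/eqP/val_inj.
    by lia.
  rewrite vE; last by case: p {h0 h1 c0 c1} => p' /=; lia.
  congr (_ * _); apply: eq_bigr => i _; have := ltn_ord i; move=> iM.
  have -> : bump 0 i = i.+1 by rewrite /bump; lia.
  have -> : bump M i = i by rewrite /bump; lia.
  by rewrite !vE //; lia.
(* The neighbour has wrapped around: the two faces lie in the hyperplanes where coordinate [j0] is
   [n.+1] and 0. Both products vanish, through [h] if [j0] is [p], and otherwise because the
   function attached to [j0] is constant on each face. *)
have top k : kuhn_vertex z r k.+1 j0 = n.+1.
  by rewrite /kuhn_vertex rj0 /=; have := ltn_ord (z j0); lia.
have bot k : (k <= M)%N -> kuhn_vertex z' s k j0 = 0%N.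
  by move=> kM; rewrite /kuhn_vertex z'0 sE rj0 eqxx ltnNge zj /=; lia.
have [pj|pj] := eqVneq p j0.
  rewrite h1 ?h0 ?mul0r //; rewrite pj ?top ?bot //.
  by case: (j0) => p' /=; lia.
case: (unliftP p j0) => [i ji|]; last by move=> e; rewrite e eqxx in pj.
have iM := ltn_ord i.
rewrite (bigD1 i) //= [in RHS](bigD1 i) //=.
have -> : bump 0 i = i.+1 by rewrite /bump; lia.
have -> : bump M i = i by rewrite /bump; lia.
rewrite !(c1 i (kuhn_vertex z r _)) -?ji ?top // !(c0 i (kuhn_vertex z' s _)) -?ji ?bot //; try lia.
by rewrite !subrr !mul0r !mulr0.
Qed.

(** A discrete Stokes formula. Expanding the factor [p] leaves two sums with the gap at [p]; moving
    one gap down to 0 and the other up to [M] makes them the two sides of [gap_sum_rot], which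
    cancel mod 2. *)
Lemma kuhn_degree_eq0 (f : 'I_N -> ('I_N -> nat) -> 'F_2) (p : 'I_N) :
  (forall x, x p = 0%N -> f p x = 0) -> (forall x, x p = n.+1 -> f p x = 0) ->
  (forall i x, i != p -> x i = 0%N -> f i x = 0) ->
  (forall i x, i != p -> x i = n.+1 -> f i x = 1) ->
  kuhn_degree f = 0.
Proof.
move=> h0 h1 c0 c1; pose c i := f (lift p i).
have -> : kuhn_degree f = gap_sum (f p) c p.+1 p + gap_sum (f p) c p p.
  rewrite /kuhn_degree /gap_sum -big_split /=; apply: eq_bigr => r _.
  rewrite -big_split /=; apply: eq_bigr => z _.
  by rewrite (bigD1_ord p) //= mulrBl oppF2.
have pM := ltn_ord p.
have up q j : (j <= M)%N -> (forall k, (k < j)%N -> q != k.+1) -> gap_sum (f p) c q j = gap_sum (f p) c q 0.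
  elim: j => // j IH jM qk; rewrite -gap_sum_move ?qk //; apply: IH; first by lia.
  by move=> k kj; apply: qk; lia.
have down q j d : (j + d = M)%N -> (forall k, (j <= k)%N -> q != k.+1) ->
    gap_sum (f p) c q j = gap_sum (f p) c q M.
  elim: d j => [|d IH] j jd qk; first by rewrite -jd addn0.
  rewrite gap_sum_move ?qk //; last by lia.
  apply: IH; first by lia.
  by move=> k kj; apply: qk; lia.
rewrite up; [|lia|by move=> k; lia].
rewrite (down p p (M - p)%N); [|lia|by move=> k; lia].
rewrite gap_sum_rot //; first exact: addF2.
- by move=> i x xi; apply: c0 => //; rewrite eq_sym neq_lift.
- by move=> i x xi; apply: c1 => //; rewrite eq_sym neq_lift.
Qed.

(** Only one simplex contributes: if [z i] is positive then the [i]-th indicator is constant on the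
    cube, and for [z] = 0 the [i]-th factor is nonzero only when [r i] is [i]. *)
Lemma kuhn_degree_indicator : kuhn_degree (fun i x => (0 < x i)%:R) = 1.
Proof.
rewrite /kuhn_degree (bigD1 (1%g : 'S_N)) //= [X in _ + X]big1 ?addr0.
  rewrite (bigD1 [ffun=> 0]) //= [X in _ + X]big1 ?addr0.
    by rewrite big1 // => i _; rewrite /kuhn_vertex !ffunE perm1 /= ltnS leqnn ltnn /= subr0.
  move=> z z0; have [i zi] : exists i, z i != 0.
    apply/existsP; apply: contraNT z0; rewrite negb_exists => /forallP zz.
    by apply/eqP/ffunP => i; rewrite ffunE; apply/eqP; have := zz i; rewrite negbK.
  rewrite (bigD1 i) //= /kuhn_vertex.
  have : (0 < z i)%N by rewrite lt0n; apply: contra zi => /eqP e; apply/eqP/val_inj.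
  by move=> zi0; rewrite !addn_gt0 zi0 /= subrr mul0r.
move=> r r1; apply: big1 => z _.
have [i ri] : exists i, r i != i.
  apply/existsP; apply: contraNT r1; rewrite negb_exists => /forallP zz.
  by apply/eqP/permP => i; rewrite perm1; apply/eqP; have := zz i; rewrite negbK.
rewrite (bigD1 i) //= /kuhn_vertex.
have -> : (r i < i.+1)%N = (r i < i)%N.
  by rewrite ltnS leq_eqVlt; case: eqVneq => // e; case/eqP: ri; apply: val_inj.
by rewrite subrr mul0r.
Qed.

(** The degree is additive in each [f i]. Replacing one function at a time by the indicator changes
    it by a degree in which one entry vanishes on both of its faces, and that degree is 0. *)
Lemma kuhn_degree_eq1 (f : 'I_N -> ('I_N -> nat) -> 'F_2) :
  (forall i x, x i = 0%N -> f i x = 0) -> (forall i x, x i = n.+1 -> f i x = 1) ->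
  kuhn_degree f = 1.
Proof.
move=> f0 f1; pose e (i : 'I_N) (x : 'I_N -> nat) : 'F_2 := (0 < x i)%:R.
pose hyb k (i : 'I_N) := if (i < k)%N then e i else f i.
suff hybE k : kuhn_degree (hyb k) = kuhn_degree f.
  rewrite -(hybE N) -kuhn_degree_indicator; congr kuhn_degree.
  by apply/funext => i; rewrite /hyb ltn_ord.
elim: k => [|k IH]; first by congr kuhn_degree; apply/funext => i; rewrite /hyb.
rewrite -IH; have [kN|kN] := ltnP k N; last first.
  by congr kuhn_degree; apply/funext => i; rewrite /hyb; have := ltn_ord i; case: ifP; case: ifP => //; lia.
pose p := Ordinal kN.
pose g i := if i == p then (fun x => f p x - e p x) else hyb k i.
apply/esym/eqP; rewrite -subr_eq0; apply/eqP.
transitivity (kuhn_degree g).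
  rewrite /kuhn_degree -sumrB; apply: eq_bigr => r _; rewrite -sumrB.
  apply: eq_bigr => z _.
  rewrite (bigD1 p) //= [X in _ - X](bigD1 p) //= [RHS](bigD1 p) //= /g eqxx /hyb /= ltnn ltnSn.
  have hybS i : i != p -> (i < k.+1)%N = (i < k)%N.
    by move=> ip; rewrite ltnS leq_eqVlt; case: eqVneq => // ik; move: ip; rewrite -val_eqE /= ik eqxx.
  rewrite [X in _ - _ * X](eq_bigr (fun i : 'I_N => 
    (hyb k i (kuhn_vertex z r i.+1) - hyb k i (kuhn_vertex z r i)))); last first.
    by move=> i ip; rewrite /hyb hybS.
  rewrite [X in _ = _ * X](eq_bigr (fun i : 'I_N => 
    (hyb k i (kuhn_vertex z r i.+1) - hyb k i (kuhn_vertex z r i)))); last first.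
    by move=> i ip; rewrite (negbTE ip) /hyb.
  by rewrite -mulrBl; congr (_ * _); rewrite !opprD !opprK addrACA.
apply: (@kuhn_degree_eq0 _ p).
- by move=> x xp; rewrite /g eqxx f0 // /e xp subrr.
- by move=> x xp; rewrite /g eqxx f1 // /e xp subrr.
- by move=> i x ip xi; rewrite /g (negbTE ip) /hyb; case: ifP => _; [rewrite /e xi|exact: f0].
- by move=> i x ip xi; rewrite /g (negbTE ip) /hyb; case: ifP => _; [rewrite /e xi|exact: f1].
Qed.

End Kuhn.
Arguments kuhn_vertex {M n}.
Arguments kuhn_degree {M}.

Lemma kuhn (M n : nat) (l : 'I_M.+1 -> ('I_M.+1 -> nat) -> bool) :
  (forall i x, x i = 0%N -> l i x = false) -> (forall i x, x i = n.+1 -> l i x = true) ->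
  exists z : 'I_M.+1 -> nat, (forall i, z i <= n)%N /\
    forall i, exists v w : 'I_M.+1 -> nat,
      [/\ forall j, (z j <= v j <= (z j).+1)%N, forall j, (z j <= w j <= (z j).+1)%N,
        l i v = false & l i w = true].
Proof.
move=> l0 l1; pose f i x : 'F_2 := (l i x)%:R.
have : kuhn_degree n f != 0.
  rewrite kuhn_degree_eq1; first exact: oner_neq0.
    by move=> i x xi; rewrite /f l0.
  by move=> i x xi; rewrite /f l1.
move=> D0; have /existsP[r] : [exists r : 'S_M.+1, exists z : {ffun 'I_M.+1 -> 'I_n.+1},
    \prod_(i < M.+1) (f i (kuhn_vertex z r i.+1) - f i (kuhn_vertex z r i)) != 0].
  apply: contraNT D0; rewrite negb_exists => /forallP H; apply/eqP.
  apply: big1 => r _; apply: big1 => z _.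
  by have := H r; rewrite negb_exists => /forallP/(_ z); rewrite negbK => /eqP.
case/existsP => z zr; exists (fun i => nat_of_ord ((z : {ffun 'I_M.+1 -> 'I_n.+1}) i)).
split; first by move=> i /=; rewrite -ltnS ltn_ord.
move=> i; move: zr; rewrite (bigD1 i) //= mulf_eq0 negb_or => /andP[+ _].
have bd k j : (z j <= kuhn_vertex z r k j <= (z j).+1)%N.
  by rewrite /kuhn_vertex leq_addr /= -(addn1 (z j)) leq_add2l leq_b1.
rewrite /f; case vE : (l i (kuhn_vertex _ _ i.+1)); case wE : (l i (kuhn_vertex _ _ i));
  rewrite ?subrr ?eqxx // => _.
- by exists (kuhn_vertex z r i), (kuhn_vertex z r i.+1); split.
- by exists (kuhn_vertex z r i.+1), (kuhn_vertex z r i); split.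
Qed.

(** * Brouwer's theorem on a box *)

(** Tychonoff's theorem for the pointwise topology. The index type will later be the real line,
    where a cluster point need not be the limit of a subsequence; hence the conclusion speaks of
    finite sets of indices. *)
Lemma bounded_cluster_point (R : realType) (I : eqType) (u : nat -> I -> R) (a b : I -> R) :
  (forall n i, a i <= u n i <= b i) ->
  exists y : I -> R, (forall i, a i <= y i <= b i) /\
    forall (s : seq I) (e : R) (N : nat), 0 < e ->
      exists n, (N <= n)%N /\ {in s, forall i, `|u n i - y i| < e}.
Proof.
move=> uab; pose A i := `[a i, b i]%classic.
have cA := @tychonoff I (fun=> R^o) A (fun i => @segment_compact R (a i) (b i)).
pose F := (u : nat -> prod_topology (fun _ : I => R^o)) @ \oo.
have FA : F [set f | forall i, A i (f i)].
  by exists 0%N => // n _ /= i; rewrite /A /= in_itv /= uab.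
have [y [Ay Fy]] := cA F _ FA.
exists y; split; first by move=> i; have := Ay i; rewrite /A /= in_itv.
move=> s e N e0.
have Uy : nbhs (y : prod_topology (fun _ : I => R^o)) [set f : prod_topology (fun _ : I => R^o) | {in s, forall i, `|f i - y i| < e}].
  elim: s => [|i s IH]; first by apply: filterS filterT => f _ i; rewrite in_nil.
  have Ui : nbhs (y : prod_topology (fun _ : I => R^o)) [set f : prod_topology (fun _ : I => R^o) | `|f i - y i| < e].
    have := @proj_continuous I (fun=> R^o) i y (ball (y i) e) (nbhsx_ballx _ _ e0).
    have -> // : [set f : prod_topology (fun _ : I => R^o) | `|f i - y i| < e] =
      @proj I (fun=> R^o) i @^-1` ball (y i) e.
    by apply/seteqP; split => f; rewrite -ball_normE /= distrC.
  apply: filterS (filterI Ui IH) => f /= [fi fs] j; rewrite inE => /orP[/eqP ->|/fs] //.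
have Vu : F [set f | exists2 n, (N <= n)%N & f = u n].
  by exists N => // n /= Nn; exists n.
have [f [[n Nn ->] un]] := Fy _ _ Vu Uy.
by exists n.
Qed.

Lemma cvg_of_inv_bound (R : realType) (v : nat -> R) (l : R) :
  (forall k, `|v k - l| < k.+1%:R^-1) -> v k @[k --> \oo] --> l.
Proof.
move=> vl; apply/cvgrPdist_lt => e e0.
have /cvgrPdist_lt/(_ e e0) := @cvg_harmonic R.
apply: filterS => k; rewrite sub0r normrN => hk; rewrite distrC.
by apply: lt_trans (vl k) (le_lt_trans _ hk); exact: ler_norm.
Qed.

Lemma bounded_subsequence (R : realType) (I : finType) (u : nat -> I -> R) (a b : I -> R) :
  (forall n i, a i <= u n i <= b i) ->
  exists (y : I -> R) (m : nat -> nat), [/\ forall i, a i <= y i <= b i,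
    forall k, (k <= m k)%N & forall i, u (m k) i @[k --> \oo] --> y i].
Proof.
move=> /bounded_cluster_point [y [yab H]].
have /choice [m mP] k : exists n, (k <= n)%N /\ {in enum I, forall i, `|u n i - y i| < k.+1%:R^-1}.
  by apply: H; rewrite invr_gt0.
exists y, m; split => // [k|i]; first by have [] := mP k.
apply: cvg_of_inv_bound => k; have [_] := mP k; apply.
by rewrite mem_enum.
Qed.

Lemma cvg_large_index (m : nat -> nat) : (forall k, (k <= m k)%N) -> m k @[k --> \oo] --> \oo.
Proof.
move=> mk; apply/cvgnyPge => A; exists A => // k /= Ak; exact: leq_trans Ak (mk k).
Qed.

(* Kuhn's lemma on finer and finer grids gives small cubes in which every
   coordinate of [F y - y] takes both signs. *)
Lemma brouwer_box (R : realType) (N : nat) (a b : 'I_N.+1 -> R)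
    (F : ('I_N.+1 -> R) -> 'I_N.+1 -> R) :
  let box y := forall i, a i <= y i <= b i in
  (forall i, a i <= b i) -> (forall y, box y -> box (F y)) ->
  (forall (u : nat -> 'I_N.+1 -> R) y, (forall n, box (u n)) -> box y ->
     (forall i, u n i @[n --> \oo] --> y i) ->
     forall i, F (u n) i @[n --> \oo] --> F y i) ->
  exists y, box y /\ forall i, F y i = y i.
Proof.
move=> box ab Fbox Fcont.
pose pt n (x : 'I_N.+1 -> nat) i := a i + (x i)%:R / n.+1%:R * (b i - a i).
have ptbox n x : (forall i, x i <= n.+1)%N -> box (pt n x).
  move=> xn i; have := ab i; have := xn i.
  rewrite -(ler_nat R) => xi abi; rewrite /pt.
  set q : R := _ / _; have : (0 <= q) && (q <= 1).
    by apply/andP; split; [exact: divr_ge0|rewrite ler_pdivrMr // mul1r].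
  by move=> /andP[? ?]; nra.
(* The label records that [F] lowers coordinate [i]; its values on the two extreme faces are
   imposed, as [kuhn] requires, and are harmless because [F] maps the box into itself. *)
pose l n i x := (n.+1 <= x i)%N || ((0 < x i)%N && (F (pt n x) i < pt n x i)).
have l0 n i (x : 'I_N.+1 -> nat) : x i = 0%N -> l n i x = false by move=> xi; rewrite /l xi.
have l1 n i (x : 'I_N.+1 -> nat) : x i = n.+1 -> l n i x = true by move=> xi; rewrite /l xi leqnn.
have /choice [z zP] n := kuhn N n (l n) (l0 n) (l1 n).
have zbox n : box (pt n (z n)).
  by apply: ptbox => i; have [zn _] := zP n; exact: leqW (zn i).
have [y [m [ybox mk zy]]] := bounded_subsequence _ _ _ _ _ zbox.
exists y; split => // i.
(* The mesh tends to 0, so every choice of vertices in the selected cubes has the same limit [y]. *)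
have near (v : nat -> 'I_N.+1 -> nat) :
    (forall k j, (z (m k) j <= v k j <= (z (m k) j).+1)%N) ->
    (forall k, box (pt (m k) (v k))) /\ forall j, pt (m k) (v k) j @[k --> \oo] --> y j.
  move=> zv; split => [k|j].
    apply: ptbox => j; have /andP[_] := zv k j; move/leq_trans; apply.
    by have [zn _] := zP (m k); rewrite ltnS.
  have -> : (fun k => pt (m k) (v k) j) = (fun k => pt (m k) (z (m k)) j +
      (pt (m k) (v k) j - pt (m k) (z (m k)) j)).
    by apply/funext => k; rewrite addrC subrK.
  rewrite -[X in _ --> X]addr0; apply: cvgD; first exact: zy.
  have harm : (m k).+1%:R^-1 * (b j - a j) @[k --> \oo] --> (0 : R).
    rewrite -(mul0r (b j - a j)); apply: cvgM; last exact: cvg_cst.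
    exact: (cvg_comp _ _ (cvg_large_index m mk) (@cvg_harmonic R)).
  apply: (squeeze_cvgr _ (cvg_cst 0) harm); apply: nearW => k /=.
  have /andP[z1 z2] := zv k j; have abj := ab j.
  rewrite /pt opprD addrACA subrr add0r -mulrBl -mulrBl -natrB //.
  have : (v k j - z (m k) j <= 1)%N by lia.
  rewrite -(ler_nat R) => vz; have i0 : 0 <= (m k).+1%:R^-1 :> R by rewrite invr_ge0.
  apply/andP; split; first by rewrite !mulr_ge0 // subr_ge0.
  by rewrite ler_wpM2r ?subr_ge0 // ler_piMl.
have /choice [v vP] k : exists v : 'I_N.+1 -> nat,
    (forall j, (z (m k) j <= v j <= (z (m k) j).+1)%N) /\ l (m k) i v = false.
  by have [_ /(_ i)[v [w [? ? ? ?]]]] := zP (m k); exists v.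
have /choice [w wP] k : exists v : 'I_N.+1 -> nat,
    (forall j, (z (m k) j <= v j <= (z (m k) j).+1)%N) /\ l (m k) i v = true.
  by have [_ /(_ i)[v' [w [? ? ? ?]]]] := zP (m k); exists w.
have [vbox vy] := near v (fun k => (vP k).1).
have [wbox wy] := near w (fun k => (wP k).1).
apply/eqP; rewrite eq_le; apply/andP; split.
  apply: (ler_cvg_to (Fcont _ _ wbox ybox wy i) (wy i)); apply: nearW => k.
  have [_] := wP k; rewrite /l => /orP[wi|/andP[_ /ltW //]].
  have -> : pt (m k) (w k) i = b i.
    have wi' : w k i = (m k).+1.
      apply/eqP; rewrite eqn_leq wi andbT; have /andP[_] := (wP k).1 i; move/leq_trans; apply.
      by have [zn _] := zP (m k); rewrite ltnS.
    by rewrite /pt wi' divff ?pnatr_eq0 // mul1r addrC subrK.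
  by have /andP[] := Fbox _ (wbox k) i.
apply: (ler_cvg_to (vy i) (Fcont _ _ vbox ybox vy i)); apply: nearW => k.
have [_] := vP k; rewrite /l => /negbT; rewrite negb_or => /andP[_].
rewrite negb_and => /orP[|]; last by rewrite -leNgt.
rewrite -eqn0Ngt => /eqP vi; rewrite [pt _ _ i]/pt vi mul0r mul0r addr0.
by have /andP[] := Fbox _ (vbox k) i.
Qed.

(** * Schauder's theorem on an order interval *)

Definition equicontinuous_family {R : realType} (E : set (R -> R)) : Prop :=
  forall t e, 0 < e -> exists2 d : R, 0 < d &
    forall f t', E f -> `|t' - t| < d -> `|f t' - f t| <= e.

(** Arzela-Ascoli: a pointwise cluster point is approximated within 1/(k+1) on the rationals among
    the first [k] codes, which gives convergence at all rationals, and equicontinuity extends it to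
    every real. *)
Lemma equicontinuous_subsequence (R : realType) (E : set (R -> R)) (u : nat -> R -> R) (a b : R -> R) :
  equicontinuous_family E -> (forall n, E (u n)) ->
  (forall n t, a t <= u n t <= b t) ->
  exists (y : R -> R) (m : nat -> nat), [/\ forall t, a t <= y t <= b t,
    forall k, (k <= m k)%N & forall t, u (m k) t @[k --> \oo] --> y t].
Proof.
move=> eqE Eu /bounded_cluster_point [y [yab H]].
pose pts k : seq R := [seq ratr q | q <- pmap (@unpickle rat) (iota 0 k)].
have /choice [m mP] k : exists n, (k <= n)%N /\ {in pts k, forall i, `|u n i - y i| < k.+1%:R^-1}.
  by apply: H; rewrite invr_gt0.
exists y, m; split => // [k|t]; first by have [] := mP k.
have cvgq (q : rat) : u (m k) (ratr q) @[k --> \oo] --> y (ratr q).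
  apply/cvgrPdist_lt => e e0.
  have /cvgrPdist_lt/(_ e e0) hk := @cvg_harmonic R.
  have hq := nbhs_infty_ge (pickle q).+1.
  apply: filterS (filterI hk hq) => k /= [ke kq].
  rewrite distrC; apply: lt_trans (_ : k.+1%:R^-1 < e); last first.
    by move: ke; rewrite sub0r normrN; apply: le_lt_trans; exact: ler_norm.
  have [_] := mP k; apply; apply: map_f; rewrite mem_pmap.
  by apply/mapP; exists (pickle q); rewrite ?pickleK // mem_iota add0n.
(* Five errors add up: two from [u (m k)] between [t] and a nearby rational, at that rational and
   across, and three more that bound the variation of [y] itself. Nothing is known yet about the
   continuity of [y], so an auxiliary index [n] close to [y] at both points is interposed. *)
apply/cvgrPdist_lt => e0 e00; pose e := e0 / 5; have e_gt0 : 0 < e by rewrite divr_gt0.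
have [d d0 dP] := eqE t e e_gt0.
have [|q] := @rat_in_itvoo R (t - d) (t + d); first by lra.
rewrite in_itv /= => /andP[q1 q2].
have tq : `|ratr q - t| < d by rewrite ltr_norml; apply/andP; split; lra.
have [n [_ yn]] := H [:: t; ratr q] e 0%N e_gt0.
have ynt : `|u n t - y t| < e by apply: yn; rewrite inE eqxx.
have ynq : `|u n (ratr q) - y (ratr q)| < e by apply: yn; rewrite !inE eqxx orbT.
have unq := dP _ _ (Eu n) tq.
have /cvgrPdist_lt/(_ e e_gt0) := cvgq q.
apply: filterS => k uk; have ukq := dP _ _ (Eu (m k)) tq.
move: ynt ynq unq uk ukq; rewrite /e !ltr_norml !ler_norml => *.
by repeat match goal with H : is_true (_ && _) |- _ => move/andP: H => [? ?] end; apply/andP; split; lra.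
Qed.

(* The node values of a step function play the role of the finite-dimensional
   unknown: the fixed points [y] of the discretised problems satisfy
   [A phi_y = phi_y] at the nodes, so equicontinuity of [A phi_y] makes the
   [phi_y] approximate fixed points. *)
Section FixedPoint.
Variables (R : realType) (a b : R -> R) (A : (R -> R) -> R -> R).
Hypotheses (ma : measurable_fun setT a) (mb : measurable_fun setT b).
Hypothesis ab : forall t, a t <= b t.
Definition order_interval : set (R -> R) :=
  [set f | measurable_fun setT f /\ forall t, a t <= f t <= b t].
Hypothesis Aab : forall f, order_interval f -> forall t, a t <= A f t <= b t.
Hypothesis Aequi : equicontinuous_family (A @` order_interval).
Hypothesis Acont : forall (u : nat -> R -> R) f, (forall n, order_interval (u n)) ->
  order_interval f -> (forall t, u n t @[n --> \oo] --> f t) ->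
  forall t, A (u n) t @[n --> \oo] --> A f t.

(** Growing [n] refines the mesh and widens the covered window [-n, n] at the same time. *)
Definition node (n : nat) (j : nat) : R := j%:R / n.+1%:R - n%:R.

Lemma node_succ n j : node n j.+1 = node n j + n.+1%:R^-1.
Proof. by rewrite /node -(natr1 j) mulrDl mul1r addrAC. Qed.

Definition clamp (lo hi x : R) : R := Num.min (Num.max lo x) hi.

(** Clamping puts the step function in the order interval for every choice of node values, and it
    costs nothing in the estimates because the clamp is 1-Lipschitz. *)
Definition step_fun (n N : nat) (y : 'I_N -> R) (t : R) : R :=
  clamp (a t) (b t) (\sum_(j < N) y j * \1_(`[node n j, node n j.+1[) t).

Lemma clamp_id lo hi x : lo <= x <= hi -> clamp lo hi x = x.
Proof. by move=> /andP[? ?]; rewrite /clamp max_r // min_l. Qed.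

Lemma clamp_itv lo hi x : lo <= hi -> lo <= clamp lo hi x <= hi.
Proof.
by move=> lh; rewrite /clamp le_min ge_min lh le_max !lexx orbT.
Qed.

Lemma clamp_dist lo hi x y : `|clamp lo hi x - clamp lo hi y| <= `|x - y|.
Proof.
rewrite ler_norml lerNl opprB /clamp /Num.min /Num.max.
have := ler_norm (x - y); have := ler_norm (y - x); rewrite (distrC y x) => *.
apply/andP; split; do !case: ifP; move=> *;
  by repeat match goal with H : (_ < _) = false |- _ => move/negbT: H; rewrite -leNgt => ? end; lra.
Qed.

Lemma step_fun_itv n N (y : 'I_N -> R) : order_interval (step_fun n N y).
Proof.
split => [|t]; last exact: clamp_itv.
apply: measurable_minr => //; apply: measurable_maxr => //.
apply: measurable_sum => j; apply: measurable_funM => //.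
Qed.

Lemma step_fun_cvg n N (u : nat -> 'I_N -> R) y :
  (forall i, u k i @[k --> \oo] --> y i) ->
  forall t, step_fun n N (u k) t @[k --> \oo] --> step_fun n N y t.
Proof.
move=> uy t; set su := fun v : 'I_N -> R => \sum_(j < N) v j * \1_(`[node n j, node n j.+1[) t.
have suc : su (u k) @[k --> \oo] --> su y.
  apply: cvg_big => [|j _]; first exact: add_continuous.
  by apply: cvgM; [exact: uy|exact: cvg_cst].
have : `|su y - su (u k)| @[k --> \oo] --> (0 : R).
  rewrite -(normr0 R); apply: cvg_norm; rewrite -(subrr (su y)).
  by apply: cvgB => //; exact: cvg_cst.
move=> /cvgrPdist_lt H; apply/cvgrPdist_lt => e e0; apply: filterS (H e e0) => k.
rewrite sub0r normrN normr_id; apply: le_lt_trans; exact: clamp_dist.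
Qed.

Lemma step_fun_node n N (y : 'I_N -> R) (j : 'I_N) t : node n j <= t < node n j.+1 ->
  step_fun n N y t = clamp (a t) (b t) (y j).
Proof.
move=> /andP[jt tj]; congr clamp; rewrite (bigD1 j) //= big1 ?addr0.
  by rewrite indicE mem_set ?mulr1 //= in_itv /= jt tj.
move=> i ij; rewrite indicE memNset ?mulr0 //= in_itv /= => /andP[it ti].
have n0 : 0 < n.+1%:R^-1 :> R by rewrite invr_gt0.
have ij' : (i <= j)%N && (j <= i)%N.
  move: (le_lt_trans it tj) (le_lt_trans jt ti).
  by rewrite !ltrD2r !ltr_pM2r // !ltr_nat !ltnS => -> ->.
by case/eqP: ij; apply: val_inj; apply/eqP; rewrite eqn_leq.
Qed.

Lemma ex_node n t : - n%:R <= t < n%:R ->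
  exists j : 'I_(n.+1 * n.*2).+1, node n j <= t < node n j.+1.
Proof.
move=> /andP[nt tn]; pose j := Num.truncn ((t + n%:R) * n.+1%:R).
have n0 : 0 < n.+1%:R :> R by [].
have [j1 j2] : (j%:R <= (t + n%:R) * n.+1%:R /\ (t + n%:R) * n.+1%:R < j.+1%:R).
  have : 0 <= (t + n%:R) * n.+1%:R by apply: mulr_ge0 => //; lra.
  by move=> /truncn_itv /andP[].
have jN : (j < (n.+1 * n.*2).+1)%N.
  rewrite ltnS -(ler_nat R); apply: le_trans j1 _.
  by rewrite natrM -muln2 natrM mulrC ler_pM2l //; lra.
exists (Ordinal jN) => /=; rewrite /node lerBlDr ltrBrDr.
by rewrite ler_pdivrMr // ltr_pdivlMr // j1 j2.
Qed.

Lemma order_interval_fixpoint : exists2 f, order_interval f & forall t, A f t = f t.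
Proof.
pose N n := (n.+1 * n.*2)%N.
have ex n : exists y : 'I_(N n).+1 -> R,
    forall i : 'I_(N n).+1, A (step_fun n _ y) (node n i) = y i.
  have [||u z ub zb uz i|y [_ yP]] := @brouwer_box R (N n)
     (fun i : 'I_(N n).+1 => a (node n i)) (fun i : 'I_(N n).+1 => b (node n i))
     (fun y (i : 'I_(N n).+1) => A (step_fun n _ y) (node n i)).
  - by move=> i; exact: ab.
  - by move=> y _ i; apply: Aab; exact: step_fun_itv.
  - apply: Acont; [by move=> k; exact: step_fun_itv|exact: step_fun_itv|].
    exact: step_fun_cvg.
  - by exists y.
pose y n := projT1 (cid (ex n)).
have yP n : forall i : 'I_(N n).+1, A (step_fun n _ (y n)) (node n i) = y n i := projT2 (cid (ex n)).
pose phi n := step_fun n _ (y n); pose psi n := A (phi n).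
have Iphi n : order_interval (phi n) by exact: step_fun_itv.
have psiab n t : a t <= psi n t <= b t by exact: Aab.
have [f [m [fab mk psif]]] := equicontinuous_subsequence R _ psi a b Aequi
  (fun n => imageP _ (Iphi n)) psiab.
have phif t : phi (m k) t @[k --> \oo] --> f t.
  have diff : (psi (m k) t - phi (m k) t) @[k --> \oo] --> (0 : R).
    apply/cvgrPdist_le => e e0; have [d d0 dP] := Aequi t e e0.
    have hd : \forall k \near \oo, (m k).+1%:R^-1 < d.
      have /cvgrPdist_lt/(_ d d0) := cvg_comp _ _ (cvg_large_index m mk) (@cvg_harmonic R).
      by apply: filterS => k; rewrite sub0r normrN; apply: le_lt_trans; exact: ler_norm.
    have ht : \forall k \near \oo, `|t| < (m k)%:R.
      have := nbhs_infty_ge (Num.truncn `|t|).+1; apply: filterS => k /= tk.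
      apply: lt_le_trans (_ : (Num.truncn `|t|).+1%:R <= _).
        by have /andP[] := truncn_itv (normr_ge0 t).
      by rewrite ler_nat (leq_trans tk).
    apply: filterS (filterI hd ht) => k [hdk]; rewrite ltr_norml => /andP[tk1 tk2].
    have [|j jt] := ex_node (m k) t; first by rewrite ltW.
    rewrite sub0r normrN /phi (step_fun_node _ _ _ _ _ jt) -(yP _ j).
    (* [psi (m k) t] lies between [a t] and [b t], hence equals its own clamp; the error is then at
       most the variation of [psi (m k)] between [t] and the node below it. *)
    rewrite -[psi (m k) t](clamp_id (a t) (b t)) //; apply: le_trans (clamp_dist _ _ _ _) _.
    rewrite distrC; apply: dP; first exact: imageP.
    have /andP[jt1 jt2] := jt; move: hdk jt1 jt2; rewrite node_succ.
    move: (node _ _) (_^-1) => p q qd pt tpq.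
    by rewrite ltr_norml; apply/andP; split; lra.
  have -> : (fun k => phi (m k) t) = (fun k => psi (m k) t - (psi (m k) t - phi (m k) t)).
    by apply/funext => k; rewrite opprB addrC subrK.
  by rewrite -[X in _ --> X]subr0; apply: cvgB.
have If : order_interval f.
  split=> //; apply: (@measurable_fun_cvg _ _ R setT (fun k => phi (m k))) => [k|t _]; last exact: phif.
  exact: (Iphi (m k)).1.
exists f => // t; have h1 := Acont _ f (fun k => Iphi (m k)) If phif t.
rewrite -(cvg_lim (@Rhausdorff R) h1); exact: (cvg_lim (@Rhausdorff R) (psif t)).
Qed.

End FixedPoint.

(** * Continuity of translations in L1 *)

Lemma ge0_cvge0 (R : realType) (u : nat -> \bar R) : (forall n, 0 <= u n)%E ->
  (forall e : R, 0 < e -> \forall n \near \oo, (u n <= e%:E)%E) ->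
  u @ \oo --> 0%E.
Proof.
move=> u0 ue; apply/fine_cvgP; split.
  by apply: filterS (ue 1 ltr01) => n un; rewrite ge0_fin_numE // (le_lt_trans un) // ltry.
apply/cvgrPdist_le => e e0; apply: filterS (ue e e0) => n un /=.
rewrite sub0r normrN ger0_norm ?fine_ge0 //.
by rewrite -lee_fin fineK // ge0_fin_numE // (le_lt_trans un) // ltry.
Qed.

Lemma cvge0_near_le (R : realType) (u : nat -> \bar R) (e : R) :
  u @ \oo --> 0%E -> 0 < e -> \forall n \near \oo, (u n <= e%:E)%E.
Proof.
move=> /fine_cvgP[ufin /cvgrPdist_le u0] e0; apply: filterS (filterI ufin (u0 e e0)) => n [un].
by rewrite sub0r normrN /= -lee_fin => une; rewrite -(fineK un) (le_trans _ une) // lee_fin ler_norm.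
Qed.

Section L1Translation.
Context {R : realType}.
Local Notation leb := (@lebesgue_measure R).
Local Open Scope ereal_scope.

(** The image of Lebesgue measure under the reflection agrees with it on half-open intervals, so
    uniqueness applies. A translation is then a product of two reflections. *)
Lemma ge0_integral_reflection (c : R) (f : R -> \bar R) :
  measurable_fun setT f -> (forall x, 0 <= f x) ->
  \int[leb]_x f (c - x)%R = \int[leb]_x f x.
Proof.
move=> mf f0; pose phi (x : measurableTypeR R) : measurableTypeR R := (c - x)%R.
have mphi : measurable_fun setT phi by apply: measurable_funB.
rewrite -[LHS]/(\int[leb]_(x in phi @^-1` setT) (f \o phi) x).
rewrite -ge0_integral_pushforward //=.
apply: eq_measure_integral => A mA _; apply/esym/lebesgue_measure_unique => //.
move=> _ [[a b]] _ <-; rewrite /pushforward /=.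
rewrite [X in _ = leb X](_ : _ = `[(c - b)%R, (c - a)%R[%classic); last first.
  apply/seteqP; split => x; rewrite /phi /= !in_itv /= => /andP[h1 h2].
    by apply/andP; split; lra.
  by apply/andP; split; lra.
rewrite !lebesgue_measure_itv /= !lte_fin -!EFinB.
have -> : ((c - b < c - a) = (a < b))%R by apply/idP/idP => h; lra.
by case: ifP => // _; congr EFin; lra.
Qed.

Lemma ge0_integral_translation (h : R) (f : R -> \bar R) :
  measurable_fun setT f -> (forall x, 0 <= f x) ->
  \int[leb]_x f (x + h)%R = \int[leb]_x f x.
Proof.
move=> mf f0; rewrite -(ge0_integral_reflection h f mf f0).
have mg : measurable_fun setT (fun x : R => f (h - x)%R).
  by apply: measurableT_comp => //; apply: measurable_funB.
rewrite -(ge0_integral_reflection 0%R _ mg (fun x => f0 (h - x)%R)).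
by apply: eq_integral => x _; rewrite sub0r opprK addrC.
Qed.

Definition cutoff (n : nat) (x : R) : R := (Num.min 1 (Num.max 0 (n.+1%:R - `|x|)))%R.

Lemma cutoff_cont n : continuous (cutoff n).
Proof.
move=> x; apply: (@continuous_min R R^o (cst 1%R) (fun x => Num.max 0 (n.+1%:R - `|x|))%R); first exact: cvg_cst.
apply: (@continuous_max R R^o (cst 0%R) (fun x => n.+1%:R - `|x|)%R); first exact: cvg_cst.
by apply: cvgB; [exact: cvg_cst|exact: norm_continuous].
Qed.

Lemma cutoff01 n x : (0 <= cutoff n x <= 1)%R.
Proof. by rewrite /cutoff le_min ge_min le_max !lexx ler01. Qed.

Lemma cutoff_out n x : (n.+1%:R <= `|x|)%R -> cutoff n x = 0%R.
Proof. by move=> nx; rewrite /cutoff max_l ?subr_le0 // min_r. Qed.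

Lemma cutoff_in n x : (`|x| <= n%:R)%R -> cutoff n x = 1%R.
Proof.
by move=> nx; rewrite /cutoff min_l // le_max; apply/orP; right; rewrite -natr1; lra.
Qed.

Lemma measurable_EFin_norm d (T : measurableType d) (D : set T) (f : T -> R) :
  measurable_fun D f -> measurable_fun D (fun x => `|f x|%:E).
Proof. by move=> mf; apply/measurable_EFinP; exact: measurableT_comp. Qed.
Arguments measurable_EFin_norm {d T D f}.

(** With a plateau function c, f - g c = f (1 - c) + (f - g) c. The first term is small by dominated
    convergence, the second by approximation on the compact interval that carries c. *)
Lemma continuous_dense_L1 (f : R -> R) (e : R) : leb.-integrable setT (EFin \o f) ->
  (0 < e)%R -> exists (g : R -> R) (L : R), [/\ continuous g,
    forall x, (L <= `|x|)%R -> g x = 0%R & \int[leb]_x `|f x - g x|%:E <= e%:E].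
Proof.
move=> intf e0; have mf : measurable_fun setT f by have /integrableP[/measurable_EFinP] := intf.
have mc n : measurable_fun setT (cutoff n) by exact: continuous_measurable_fun (cutoff_cont n).
have mfc n : measurable_fun setT (fun x => f x * (1 - cutoff n x))%R.
  by apply: measurable_funM => //; apply: measurable_funB.
have e20 : (0 < e / 2)%R by rewrite divr_gt0.
have [n ne] : exists n, \int[leb]_x `|f x * (1 - cutoff n x)|%:E <= (e / 2)%:E.
  suff : \int[leb]_x `|f x * (1 - cutoff n x)|%:E @[n --> \oo] --> 0.
    by move=> /cvge0_near_le/(_ e20)[n _ /(_ n (leqnn n)) ?]; exists n.
  rewrite -(integral0 leb setT).
  apply: (@dominated_cvg _ _ R leb setT measurableT
    (fun n x => `|f x * (1 - cutoff n x)|%:E) (cst 0) (EFin \o (fun x => `|f x|%R))) => //.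
  - by move=> n; exact: measurable_EFin_norm (mfc n).
  - move=> x _; apply: cvg_near_cst.
    have := nbhs_infty_ge (Num.truncn `|x|).+1; apply: filterS => n /= xn.
    rewrite cutoff_in ?subrr ?mulr0 ?normr0 //.
    have /andP[_ /ltW xt] := truncn_itv (normr_ge0 x).
    by apply: le_trans xt _; rewrite ler_nat.
  - by have := integrable_abse intf.
  - move=> n x _ /=; rewrite lee_fin normr_id normrM ler_piMr // ger0_norm.
      by have /andP[] := cutoff01 n x; lra.
    by have /andP[] := cutoff01 n x; lra.
pose E : set (measurableTypeR R) := `[(- n.+1%:R)%R, n.+1%:R]%classic.
have mE : measurable E by exact: measurable_itv.
have [||gs [gc gi /cvge0_near_le/(_ e20)[m _ /(_ m (leqnn m)) gm]]] :=
    @approximation_continuous_integrable R E f mE.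
  have EI := @lebesgue_measure_itv R `[(- n.+1%:R)%R, n.+1%:R].
  suff : leb [set` `[(- n.+1%:R)%R, n.+1%:R]] < +oo by [].
  by rewrite EI /=; case: ifP => // _; rewrite -EFinB ltry.
  exact: integrableS intf.
exists (fun x => gs m x * cutoff n x)%R, n.+1%:R; split.
- by move=> x; apply: cvgM; [exact: gc|exact: cutoff_cont].
- by move=> x nx; rewrite cutoff_out ?mulr0.
have mg : measurable_fun setT (gs m) by exact: continuous_measurable_fun.
have mr : measurable_fun setT ((fun z => `|(f z - gs m z)%:E|) \_ E).
  have mfg : measurable_fun setT (fun z => `|(f z - gs m z)%:E|).
    by apply: measurable_EFin_norm; exact: measurable_funB.
  exact: (measurable_restrictT _ mE).1 (measurable_funTS mfg).
apply: (@le_trans _ _ (\int[leb]_x (`|f x * (1 - cutoff n x)|%:E +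
    ((fun z => `|(f z - gs m z)%:E|) \_ E) x))).
  apply: ge0_le_integral => //.
  - apply: measurable_EFin_norm; apply: measurable_funB => //; exact: (measurable_funM mg (mc n)).
  - by apply: emeasurable_funD => //; exact: (measurable_EFin_norm (mfc n)).
  - move=> x _; have -> : (f x - gs m x * cutoff n x = f x * (1 - cutoff n x) + (f x - gs m x) * cutoff n x)%R by lra.
    apply: (@le_trans _ _ (`|f x * (1 - cutoff n x)|%:E + `|(f x - gs m x) * cutoff n x|%:E)).
      by rewrite -EFinD lee_fin ler_normD.
    apply: leeD => //; rewrite patchE; case: ifPn => [_|].
      rewrite /= lee_fin normrM ler_piMr //.
      by have /andP[? ?] := cutoff01 n x; rewrite ger0_norm.
    rewrite notin_setE /E /= in_itv /= => /negP xE; rewrite cutoff_out ?mulr0 ?normr0 //.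
    rewrite leNgt; apply: contra xE; rewrite ltr_norml => /andP[? ?].
    by apply/andP; split; exact: ltW.
rewrite ge0_integralD //; last 2 first.
- exact: (measurable_EFin_norm (mfc n)).
- by move=> x _; rewrite patchE; case: ifP.
have -> : e%:E = (e / 2)%:E + (e / 2)%:E :> \bar R by rewrite -EFinD; congr EFin; lra.
by apply: leeD => //; rewrite -integral_mkcond.
Qed.

(** The shifts are bounded, so all the differences live on one bounded interval and a multiple of
    its indicator dominates them. *)
Lemma continuous_L1_translation (g : R -> R) (L : R) (h : nat -> R) : continuous g ->
  (forall x, L <= `|x| -> g x = 0)%R -> h n @[n --> \oo] --> (0 : R)%R ->
  \int[leb]_x `|g (x + h n) - g x|%:E @[n --> \oo] --> 0.
Proof.
move=> gc gL h0.
have [M M0 gM] : exists2 M, (0 <= M)%R & forall x, (`|g x| <= M)%R.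
  have L0 : (- `|L| <= `|L|)%R by apply: le_trans (normr_ge0 L); rewrite oppr_le0.
  have ng : continuous (fun x => `|g x|%R).
    by move=> x; apply: continuous_comp; [exact: gc|exact: norm_continuous].
  have [c _ cP] := EVT_max L0 (continuous_subspaceT ng).
  exists `|g c|%R => // x; have [xL|xL] := leP `|x|%R `|L|%R.
    by apply: cP; rewrite in_itv /= -ler_norml.
  by rewrite gL ?normr0 // (le_trans (ler_norm L)) // ltW.
have [B hB] : exists B, forall n, (`|h n| <= B)%R.
  have hc : cvgn h by apply/cvg_ex; exists 0%R.
  have [B [_ hB]] := cvg_seq_bounded hc.
  by exists (B + 1)%R => n; apply: hB => //; rewrite ltrDl.
have mg : measurable_fun setT g by exact: continuous_measurable_fun.
have mgh n : measurable_fun setT (fun x : R => g (x + h n)%R).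
  by apply: measurableT_comp => //; exact: measurable_funD.
rewrite -(integral0 leb setT).
apply: (@dominated_cvg _ _ R leb setT measurableT
    (fun n x => `|g (x + h n) - g x|%:E) (cst 0)
    (fun x => (2 * M)%:E * (\1_(`[(- (`|L| + B))%R, (`|L| + B)%R]%classic) x)%:E)) => //.
- by move=> n; apply: measurable_EFin_norm; exact: (measurable_funB (mgh n) mg).
- move=> x _; apply: cvg_EFin; first exact: nearW.
  rewrite /= -(normr0 R); apply: cvg_norm; rewrite -(subrr (g x)); apply: cvgB; last exact: cvg_cst.
  apply: continuous_cvg; first exact: gc.
  by rewrite -[X in _ --> X]addr0; apply: cvgD => //; exact: cvg_cst.
- by apply: integrableZl => //; exact: integrable_indic_itv.
- move=> n x _; rewrite /= -EFinM lee_fin normr_id indicE.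
  case: (boolP (x \in _)) => [_|].
    rewrite mulr1; apply: le_trans (ler_normB _ _) _.
    by have := gM (x + h n)%R; have := gM x; lra.
  rewrite notin_setE /= in_itv /= => /negP; rewrite -ler_norml -ltNge mulr0 => xL.
  have hn := hB n; have B0 : (0 <= B)%R := le_trans (normr_ge0 _) hn.
  have := ler_norm L => LL.
  rewrite !gL ?subrr ?normr0 //; first by lra.
  have := ler_normB (x + h n)%R (h n); rewrite addrK; lra.
Qed.

Lemma L1_translation_continuous (f : R -> R) (h : nat -> R) :
  leb.-integrable setT (EFin \o f) -> h n @[n --> \oo] --> (0 : R)%R ->
  \int[leb]_x `|f (x + h n) - f x|%:E @[n --> \oo] --> 0.
Proof.
move=> intf h0; apply: ge0_cvge0 => [n|e e0]; first exact: integral_ge0.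
have e30 : (0 < e / 3)%R by rewrite divr_gt0.
have [g [L [gc gL fg]]] := continuous_dense_L1 f _ intf e30.
have mf : measurable_fun setT f by have /integrableP[/measurable_EFinP] := intf.
have mg : measurable_fun setT g by exact: continuous_measurable_fun.
have mt (k : R -> R) (c : R) : measurable_fun setT k -> measurable_fun setT (fun x : R => k (x + c)%R).
  by move=> mk; apply: measurableT_comp => //; exact: measurable_funD.
have := cvge0_near_le _ _ _ (continuous_L1_translation g L h gc gL h0) e30.
apply: filterS => n gn.
have mfg : measurable_fun setT (fun x : R => f x - g x)%R by exact: (measurable_funB mf mg).
have m1 : measurable_fun setT (fun x : R => `|f (x + h n) - g (x + h n)|%:E).
  by apply: measurable_EFin_norm; exact: (mt (fun x : R => f x - g x)%R _ mfg).
have m2 : measurable_fun setT (fun x : R => `|g (x + h n) - g x|%:E).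
  by apply: measurable_EFin_norm; exact: (measurable_funB (mt _ _ mg) mg).
have m3 : measurable_fun setT (fun x : R => `|f x - g x|%:E) by exact: (measurable_EFin_norm mfg).
apply: (@le_trans _ _ (\int[leb]_x (`|f (x + h n) - g (x + h n)|%:E +
    (`|g (x + h n) - g x|%:E + `|f x - g x|%:E)))).
  apply: ge0_le_integral => //.
  - by exact: (measurable_EFin_norm (measurable_funB (mt _ _ mf) mf)).
  - exact: (emeasurable_funD m1 (emeasurable_funD m2 m3)).
  - move=> x _; rewrite -!EFinD lee_fin (distrC (f x)).
    have -> : (f (x + h n) - f x = (f (x + h n) - g (x + h n)) + ((g (x + h n) - g x) + (g x - f x)))%R by lra.
    by apply: le_trans (ler_normD _ _) _; rewrite lerD2l ler_normD.
rewrite ge0_integralD //; last 2 first.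
- by move=> x _; exact: adde_ge0.
- exact: (emeasurable_funD m2 m3).
rewrite ge0_integralD //.
rewrite (ge0_integral_translation (h n) (fun x : R => `|f x - g x|%:E)) //.
have -> : e%:E = (e / 3)%:E + ((e / 3)%:E + (e / 3)%:E) :> \bar R by rewrite -!EFinD; congr EFin; lra.
by apply: leeD => //; exact: leeD.
Qed.
End L1Translation.

(** * The integral operator *)

Lemma cvg0_of_norm (R : realType) (u : nat -> R) :
  `|u n| @[n --> \oo] --> (0 : R) -> u n @[n --> \oo] --> (0 : R).
Proof.
move=> /cvgrPdist_lt H; apply/cvgrPdist_lt => e e0; apply: filterS (H e e0) => n.
by rewrite !sub0r !normrN normr_id.
Qed.

Section KernelIntegral.
Context {R : realType} {d : measure_display} {X : measurableType d}.
Variables (mu : {finite_measure set X -> \bar R}) (K : R -> X -> R).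
Hypothesis K0 : forall s tau, 0 <= K s tau.
Hypothesis Kint : ((@lebesgue_measure R) \x mu)%E.-integrable setT
  (fun p : R * X => (K p.1 p.2)%:E).
Local Notation leb := (@lebesgue_measure R).
Local Notation P := (mu \x leb)%E.
Local Open Scope ereal_scope.
Implicit Types F G : X * R -> R.

(** The factors are ordered as X x R, opposite to the integrability hypothesis on [K], so that
    Tonelli yields the iterated integral of [Aop] with [mu] outside. *)
Definition kernel_integral (F : X * R -> R) : \bar R :=
  \int[P]_p (K p.2 p.1 * F p)%:E.

Let mKswap : measurable_fun setT (fun p : R * X => K p.1 p.2).
Proof. by have /integrableP[/measurable_EFinP] := Kint. Qed.

Lemma measurable_comp_fst (F : R -> X -> R) (u : X * R -> R) :
  measurable_fun setT (fun p : R * X => F p.1 p.2) -> measurable_fun setT u ->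
  measurable_fun setT (fun p : X * R => F (u p) p.1).
Proof.
move=> mF mu'; have mp : measurable_fun setT (fun p : X * R => (u p, p.1)).
  exact: (measurable_fun_pair mu' measurable_fst).
exact: (measurableT_comp mF mp).
Qed.

Let mK : measurable_fun setT (fun p : X * R => K p.2 p.1).
Proof. exact: (measurable_comp_fst K snd mKswap measurable_snd). Qed.

Let mKF F : measurable_fun setT F -> measurable_fun setT (fun p : X * R => (K p.2 p.1 * F p)%:E).
Proof. by move=> mF; apply/measurable_EFinP; exact: (measurable_funM mK mF). Qed.

Lemma kernel_integral_iterated F : measurable_fun setT F -> (forall p, 0 <= F p)%R ->
  \int[mu]_tau \int[leb]_s (K s tau * F (tau, s))%:E = kernel_integral F.
Proof.
move=> mF F0; rewrite /kernel_integral fubini_tonelli1 //; first exact: mKF.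
by move=> p; rewrite lee_fin mulr_ge0.
Qed.

Lemma kernel_integral_ge0 F : (forall p, 0 <= F p)%R -> 0 <= kernel_integral F.
Proof. by move=> F0; apply: integral_ge0 => p _; rewrite lee_fin mulr_ge0. Qed.

Lemma le_kernel_integral F G : measurable_fun setT F -> measurable_fun setT G ->
  (forall p, 0 <= F p)%R -> (forall p, F p <= G p)%R ->
  kernel_integral F <= kernel_integral G.
Proof.
move=> mF mG F0 FG; rewrite /kernel_integral; apply: ge0_le_integral => //; [|exact: (mKF _ mF)|exact: (mKF _ mG)|].
  by move=> p _; rewrite lee_fin mulr_ge0.
by move=> p _; rewrite lee_fin ler_wpM2l.
Qed.

Lemma kernel_integralD F G : measurable_fun setT F -> measurable_fun setT G ->
  (forall p, 0 <= F p)%R -> (forall p, 0 <= G p)%R ->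
  kernel_integral (fun p => F p + G p)%R = kernel_integral F + kernel_integral G.
Proof.
move=> mF mG F0 G0; rewrite /kernel_integral -ge0_integralD //.
- by apply: eq_integral => p _; rewrite -EFinD mulrDr.
- by move=> p _; rewrite lee_fin mulr_ge0.
- exact: (mKF _ mF).
- by move=> p _; rewrite lee_fin mulr_ge0.
- exact: (mKF _ mG).
Qed.

Lemma kernel_integralZ (c : R) F : measurable_fun setT F -> (0 <= c)%R ->
  (forall p, 0 <= F p)%R ->
  kernel_integral (fun p => c * F p)%R = c%:E * kernel_integral F.
Proof.
move=> mF c0 F0; rewrite /kernel_integral -ge0_integralZl //.
- by apply: eq_integral => p _; rewrite -EFinM mulrCA.
- exact: mKF.
- by move=> p _; rewrite lee_fin mulr_ge0.
Qed.

Lemma kernel_integral1_lty : kernel_integral (fun=> 1%R) < +oo.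
Proof.
have /integrableP[mKE Klty] := Kint.
have mabs : measurable_fun setT (fun p : R * X => `|(K p.1 p.2)%:E|).
  exact: measurableT_comp.
have := @fubini_tonelli2 _ _ (measurableTypeR R) X R leb mu _ mabs (fun p => abse_ge0 _).
move=> fub; move: Klty; rewrite [X in X < _ -> _]fub.
rewrite -kernel_integral_iterated; [|exact: measurable_cst|by move=> p; exact: ler01].
apply: le_lt_trans; rewrite le_eqVlt; apply/orP; left; apply/eqP.
apply: eq_integral => tau _.
rewrite /fubini_G; apply: eq_integral => s _.
by rewrite mulr1 /comp /= ger0_norm.
Qed.

Lemma kernel_integral_fin F (M : R) : measurable_fun setT F ->
  (forall p, 0 <= F p <= M)%R -> kernel_integral F \is a fin_num.
Proof.
move=> mF FM; have F0 p : (0 <= F p)%R by have /andP[] := FM p.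
rewrite ge0_fin_numE ?kernel_integral_ge0 //.
have [M0|M0] := leP 0%R M; last first.
  apply: (@le_lt_trans _ _ (kernel_integral (fun=> 1%R))); last exact: kernel_integral1_lty.
  by apply: le_kernel_integral => // p; have /andP[h1 h2] := FM p; lra.
apply: (@le_lt_trans _ _ (kernel_integral (fun=> M * 1)%R)).
  by apply: le_kernel_integral => // p; have /andP[_] := FM p; rewrite mulr1.
rewrite (kernel_integralZ M (fun=> 1%R)) //; apply: lte_mul_pinfty => //.
exact: kernel_integral1_lty.
Qed.

Lemma kernel_integral_cvg (F : nat -> X * R -> R) F' (M : R) :
  (forall n, measurable_fun setT (F n)) -> measurable_fun setT F' ->
  (forall n p, 0 <= F n p <= M)%R -> (forall p, F n p @[n --> \oo] --> F' p) ->
  kernel_integral (F n) @[n --> \oo] --> kernel_integral F'.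
Proof.
move=> mF mF' FM FF'.
apply: (@dominated_cvg _ _ R P setT measurableT _ _ (fun p => M%:E * (K p.2 p.1)%:E)) => //.
- by move=> n; exact: mKF.
- move=> p _; apply: cvg_EFin; first exact: nearW.
  by apply: cvgM; [exact: cvg_cst|exact: FF'].
- apply: integrableZl => //; apply/integrableP; split; first exact/measurable_EFinP.
  have := kernel_integral1_lty; congr (_ < _); apply: eq_integral => p _ /=.
  by rewrite mulr1 ger0_norm.
- move=> n p _ /=; rewrite -EFinM lee_fin mulrC; have /andP[h1 h2] := FM n p.
  by rewrite normrM !ger0_norm // ler_wpM2r.
Qed.

Lemma kernel_integral_fst (f : X -> R) : measurable_fun setT f -> (forall tau, 0 <= f tau)%R ->
  kernel_integral (fun p => f p.1) = \int[mu]_tau ((f tau)%:E * Kmass K tau).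
Proof.
move=> mf f0; rewrite -kernel_integral_iterated //=; last exact: measurableT_comp.
apply: eq_integral => tau _; rewrite /Kmass -ge0_integralZl //.
- by apply: eq_integral => s _; rewrite -EFinM mulrC.
- by apply/measurable_EFinP; exact: (measurable_fun_pair2 tau mK).
- by move=> s _; rewrite lee_fin.
- by rewrite lee_fin.
Qed.

Lemma Kmass_ge0 tau : 0 <= Kmass K tau.
Proof. by apply: integral_ge0 => s _; rewrite lee_fin. Qed.

Let mK1 tau : measurable_fun setT (fun s : R => K s tau).
Proof. exact: (measurable_fun_pair2 tau mK). Qed.

Let mshift (h : R) : measurable_fun setT (fun p : X * R => K (p.2 + h)%R p.1).
Proof.
by apply: (measurable_comp_fst K _ mKswap); exact: (measurable_funD measurable_snd (measurable_cst h)).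
Qed.

Let mreflect (c : R) : measurable_fun setT (fun p : X * R => K (c - p.2)%R p.1).
Proof.
by apply: (measurable_comp_fst K _ mKswap); exact: (measurable_funB (measurable_cst c) measurable_snd).
Qed.

Lemma Kmass_integrable : mu.-integrable setT (Kmass K).
Proof.
have mKm : measurable_fun setT (Kmass K).
  apply: (@measurable_fun_fubini_tonelli_F _ _ X (measurableTypeR R) R leb (fun p : X * R => (K p.2 p.1)%:E)).
    exact/measurable_EFinP.
  by move=> p; rewrite lee_fin.
apply/integrableP; split => //.
have := kernel_integral1_lty; rewrite (kernel_integral_fst (fun=> 1%R)) //.
by congr (_ < _); apply: eq_integral => tau _; rewrite mul1e gee0_abs // Kmass_ge0.
Qed.

Definition kernel_modulus (h : R) : \bar R :=
  \int[P]_p `|K (p.2 + h)%R p.1 - K p.2 p.1|%:E.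

(** Dominated convergence in [tau]: where [Kmass K tau] is finite, hence almost everywhere, the
    inner integral tends to 0 by continuity of translations in L1, and it never exceeds twice
    [Kmass K tau]. *)
Lemma kernel_modulus_cvg (h : nat -> R) : h n @[n --> \oo] --> (0 : R)%R ->
  kernel_modulus (h n) @[n --> \oo] --> 0.
Proof.
move=> h0; pose w n (p : X * R) : \bar R := `|K (p.2 + h n)%R p.1 - K p.2 p.1|%:E.
have mw n : measurable_fun setT (w n).
  by apply: measurable_EFin_norm; exact: (measurable_funB (mshift (h n)) mK).
have w0 n p : 0 <= w n p by rewrite lee_fin.
have wE n : kernel_modulus (h n) = \int[mu]_tau \int[leb]_s w n (tau, s).
  have := @fubini_tonelli1 _ _ X (measurableTypeR R) R mu leb (w n) (mw n) (w0 n).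
  exact.
under eq_cvg do rewrite wE.
rewrite -(integral0 mu setT).
have iK2 : mu.-integrable setT (fun tau => Kmass K tau + Kmass K tau).
  by apply: integrableD => //; exact: Kmass_integrable.
have [] // := @dominated_convergence _ _ R mu setT measurableT
  (fun n tau => \int[leb]_s w n (tau, s)) (cst 0) (fun tau => Kmass K tau + Kmass K tau) _ _ _ iK2.
- by move=> n; exact: (@measurable_fun_fubini_tonelli_F _ _ X (measurableTypeR R) R leb (w n) (mw n) (w0 n)).
- apply: filterS (integrable_ae measurableT Kmass_integrable) => tau /(_ I) Kfin _.
  apply: (L1_translation_continuous (fun s => K s tau)) => //.
  apply/integrableP; split; first by apply/measurable_EFinP; exact: mK1.
  move: Kfin; rewrite ge0_fin_numE ?Kmass_ge0 //; congr (_ < _); apply: eq_integral => s _ /=.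
  by rewrite ger0_norm.
- apply: nearW => tau n _; rewrite gee0_abs; last exact: integral_ge0.
  have mh : measurable_fun setT (fun s : R => K (s + h n)%R tau).
    exact: (measurable_fun_pair2 tau (mshift (h n))).
  have E0 (f : R -> R) : measurable_fun setT f -> measurable_fun setT (EFin \o f).
    by move=> ?; exact/measurable_EFinP.
  apply: (@le_trans _ _ (\int[leb]_s ((K (s + h n)%R tau)%:E + (K s tau)%:E))).
    apply: ge0_le_integral => //.
    + by apply: measurable_EFin_norm; exact: (measurable_funB mh (mK1 tau)).
    + exact: (emeasurable_funD (E0 _ mh) (E0 _ (mK1 tau))).
    + by move=> s _; rewrite -EFinD lee_fin (le_trans (ler_normB _ _)) // !ger0_norm.
  rewrite ge0_integralD //; [|by move=> s _; rewrite lee_fin|exact: (E0 _ mh)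
    |by move=> s _; rewrite lee_fin|exact: (E0 _ (mK1 tau))].
  rewrite (ge0_integral_translation (h n) (fun s => (K s tau)%:E)) //; first exact: (E0 _ (mK1 tau)).
  by move=> s; rewrite lee_fin.
Qed.

Lemma kernel_modulus_small (e : R) : (0 < e)%R ->
  exists2 r : R, (0 < r)%R & forall h, (`|h| < r)%R -> kernel_modulus h <= e%:E.
Proof.
move=> e0; apply: contrapT => H.
have /choice[h hP] n : exists h, (`|h| < n.+1%:R^-1)%R /\ ~ kernel_modulus h <= e%:E.
  apply: contrapT => nh; apply: H; exists n.+1%:R^-1%R; first by rewrite invr_gt0.
  by move=> h hn; apply: contrapT => hk; apply: nh; exists h.
have h0 : h n @[n --> \oo] --> (0 : R)%R.
  apply: (@cvg0_of_norm R h); apply: (squeeze_cvgr _ (cvg_cst 0%R) (@cvg_harmonic R)).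
  by apply: nearW => n; rewrite normr_ge0 ltW //; exact: (hP n).1.
have [n _ /(_ n (leqnn n))] := cvge0_near_le _ _ _ (kernel_modulus_cvg h h0) e0.
exact: (hP n).2.
Qed.

(** * The convolution operator of a bounded nonlinearity and its equicontinuity *)

Section Operator.
Variables (G : R -> X -> R) (M : R).
Hypothesis mG : measurable_fun setT (fun p : R * X => G p.1 p.2).
Hypothesis GM : forall v tau, (0 <= G v tau <= M)%R.

Definition conv_op (phi : R -> R) (t : R) : R :=
  fine (kernel_integral (fun p => G (phi (t - p.2)%R) p.1)).

Lemma measurable_conv_integrand phi t : measurable_fun setT phi ->
  measurable_fun setT (fun p : X * R => G (phi (t - p.2)%R) p.1).
Proof.
move=> mphi; apply: (measurable_comp_fst G _ mG); apply: (measurableT_comp mphi).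
exact: (measurable_funB (measurable_cst t) measurable_snd).
Qed.

Lemma conv_opE phi t : measurable_fun setT phi ->
  (conv_op phi t)%:E = kernel_integral (fun p => G (phi (t - p.2)%R) p.1).
Proof.
move=> mphi; rewrite fineK //; apply: (kernel_integral_fin _ M).
  exact: measurable_conv_integrand.
by move=> p; exact: GM.
Qed.

Lemma Aop_conv_op phi t : measurable_fun setT phi -> Aop mu K G phi t = (conv_op phi t)%:E.
Proof.
move=> mphi; rewrite conv_opE // -kernel_integral_iterated //.
  exact: measurable_conv_integrand.
by move=> p; have /andP[] := GM (phi (t - p.2)%R) p.1.
Qed.

(** This form moves [t] out of the argument of [phi], so that increments in [t] can be estimated
    without any regularity of [phi]. *)
Lemma conv_op_reflect phi t : measurable_fun setT phi ->
  (conv_op phi t)%:E = \int[P]_p (K (t - p.2)%R p.1 * G (phi p.2) p.1)%:E.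
Proof.
move=> mphi; rewrite -Aop_conv_op //.
have mint : measurable_fun setT (fun p : X * R => (K (t - p.2)%R p.1 * G (phi p.2) p.1)%:E).
  apply/measurable_EFinP; apply: (measurable_funM (mreflect t)).
  by apply: (measurable_comp_fst G _ mG); exact: (measurableT_comp mphi measurable_snd).
have int0 (p : X * R) : 0 <= (K (t - p.2)%R p.1 * G (phi p.2) p.1)%:E.
  by rewrite lee_fin mulr_ge0 //; have /andP[] := GM (phi p.2) p.1.
rewrite [RHS](@fubini_tonelli1 _ _ X (measurableTypeR R) R mu leb _ mint int0).
apply: eq_integral => tau _; rewrite /fubini_F /=.
rewrite -(ge0_integral_reflection t) //.
- by apply: eq_integral => s _; rewrite subKr.
- apply/measurable_EFinP; apply: (measurable_funM (mK1 tau)).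
  exact: (measurable_fun_pair2 tau (measurable_conv_integrand phi t mphi)).
- by move=> s; rewrite lee_fin mulr_ge0 //; have /andP[] := GM (phi (t - s)%R) tau.
Qed.

Lemma kernel_modulus_reflect t t' : kernel_modulus (t' - t) =
  \int[P]_p `|K (t' - p.2)%R p.1 - K (t - p.2)%R p.1|%:E.
Proof.
have m1 : measurable_fun setT (fun p : X * R => `|K (p.2 + (t' - t))%R p.1 - K p.2 p.1|%:E).
  by apply: measurable_EFin_norm; exact: (measurable_funB (mshift _) mK).
have m2 : measurable_fun setT (fun p : X * R => `|K (t' - p.2)%R p.1 - K (t - p.2)%R p.1|%:E).
  by apply: measurable_EFin_norm; exact: (measurable_funB (mreflect _) (mreflect _)).
rewrite /kernel_modulus [LHS](@fubini_tonelli1 _ _ X (measurableTypeR R) R mu leb _ m1 (fun=> normr_ge0 _)).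
rewrite [RHS](@fubini_tonelli1 _ _ X (measurableTypeR R) R mu leb _ m2 (fun=> normr_ge0 _)).
apply: eq_integral => tau _; rewrite /fubini_F /= -(ge0_integral_reflection t) //.
  apply: eq_integral => s _.
  by have -> : (t - s + (t' - t) = t' - s)%R by lra.
apply: measurable_EFin_norm; apply: (measurable_funB _ (mK1 tau)).
exact: (measurable_fun_pair2 tau (mshift (t' - t))).
Qed.

Lemma conv_op_modulus phi t t' : measurable_fun setT phi ->
  (conv_op phi t')%:E <= (conv_op phi t)%:E + M%:E * kernel_modulus (t' - t).
Proof.
move=> mphi; have M0 : (0 <= M)%R by have /andP[h1 h2] := GM 0%R point; exact: le_trans h1 h2.
have mGphi : measurable_fun setT (fun p : X * R => G (phi p.2) p.1).
  by apply: (measurable_comp_fst G _ mG); exact: (measurableT_comp mphi measurable_snd).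
have mKG u : measurable_fun setT (fun p : X * R => (K (u - p.2)%R p.1 * G (phi p.2) p.1)%:E).
  by apply/measurable_EFinP; exact: (measurable_funM (mreflect u) mGphi).
have mKK : measurable_fun setT (fun p : X * R => `|K (t' - p.2)%R p.1 - K (t - p.2)%R p.1|%:E).
  by apply: measurable_EFin_norm; exact: (measurable_funB (mreflect _) (mreflect _)).
have KG0 u p : 0 <= (K (u - p.2)%R p.1 * G (phi p.2) p.1)%:E.
  by rewrite lee_fin mulr_ge0 //; have /andP[] := GM (phi p.2) p.1.
rewrite !conv_op_reflect // kernel_modulus_reflect.
have M0' : 0 <= M%:E by rewrite lee_fin.
rewrite -(ge0_integralZl P measurableT mKK _ M0') //.
rewrite -ge0_integralD //; last 3 first.
- exact: (mKG t).
- by move=> p _; rewrite -EFinM lee_fin mulr_ge0.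
- exact: (measurable_funeM _ mKK).
apply: ge0_le_integral => //.
- exact: (mKG t').
- exact: (emeasurable_funD (mKG t) (measurable_funeM _ mKK)).
- move=> p _; rewrite -EFinM -EFinD lee_fin; have /andP[G0 G1] := GM (phi p.2) p.1.
  have := ler_norm (K (t' - p.2) p.1 - K (t - p.2) p.1)%R.
  have := normr_ge0 (K (t' - p.2) p.1 - K (t - p.2) p.1)%R.
  move: `|_|%R => N N0 NK; apply: (@le_trans _ _ ((K (t - p.2) p.1 + N) * G (phi p.2) p.1)%R).
    by rewrite ler_wpM2r //; lra.
  by rewrite mulrDl lerD2l mulrC ler_wpM2r.
Qed.

Lemma conv_op_equicontinuous (t e : R) : (0 < e)%R -> exists2 r : R, (0 < r)%R &
  forall phi t', measurable_fun setT phi -> (`|t' - t| < r)%R ->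
    (`|conv_op phi t' - conv_op phi t| <= e)%R.
Proof.
move=> e0; have M0 : (0 <= M)%R by have /andP[h1 h2] := GM 0%R point; exact: le_trans h1 h2.
have M10 : (0 < M + 1)%R by apply: ltr_wpDl.
have [r r0 rP] := kernel_modulus_small (e / (M + 1)) (divr_gt0 e0 M10).
exists r => // phi t' mphi tt'.
have bound u u' : (`|u' - u| < r)%R -> (conv_op phi u' <= conv_op phi u + e)%R.
  move=> uu; rewrite -lee_fin; apply: le_trans (conv_op_modulus phi u u' mphi) _.
  rewrite EFinD leeD2l //; apply: (@le_trans _ _ (M%:E * (e / (M + 1))%:E)).
    by apply: lee_wpmul2l; [rewrite lee_fin|exact: rP].
  by rewrite -EFinM lee_fin mulrA ler_pdivrMr // mulrC ler_pM2l // lerDl.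
have h1 := bound t t' tt'; have h2 := bound t' t; rewrite distrC in h2.
by have := h2 tt'; rewrite ler_norml => h3; apply/andP; split; lra.
Qed.

Lemma conv_op_cvg (u : nat -> R -> R) (phi : R -> R) (t : R) : (forall tau, continuous (G^~ tau)) ->
  (forall n, measurable_fun setT (u n)) -> measurable_fun setT phi ->
  (forall s, u n s @[n --> \oo] --> phi s) ->
  conv_op (u n) t @[n --> \oo] --> conv_op phi t.
Proof.
move=> cG mun mphi uphi; apply: fine_cvg; rewrite conv_opE //.
apply: (kernel_integral_cvg _ _ M) => //.
- by move=> n; exact: measurable_conv_integrand.
- exact: measurable_conv_integrand.
- move=> p; exact: (cvg_comp (fun n => u n (t - p.2)%R) (fun v => G v p.1) (uphi _) (cG p.1 _)).
Qed.

End Operator.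
End KernelIntegral.

(** * Attracting interval maps *)

Section Interval.
Variables (R : realType) (z kappa : R).
Hypothesis kz : 0 < kappa <= z.

Definition attracts (H : R -> R) : Prop :=
  [/\ continuous H, forall x, 0 < x <= z -> 0 < H x <= z &
      forall x, 0 < x <= z -> iter n H x @[n --> \oo] --> kappa].

Lemma attracts_fixed H x : attracts H -> 0 < x <= z -> H x = x -> x = kappa.
Proof.
move=> [_ _ Hk] xz Hx; have := Hk x xz.
have -> : (fun n => iter n H x) = (fun=> x) by apply/funext; elim=> //= n ->.
by move=> xk; rewrite -(cvg_lim (@Rhausdorff R) xk) lim_cst.
Qed.

(** A sign change of H - id produces a fixed point in between, and [kappa] is the only fixed point
    in the interval. *)
Lemma attracts_cross H x y : attracts H -> 0 < x -> x <= y -> y <= z ->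
  (H x - x) * (H y - y) <= 0 -> x <= kappa <= y.
Proof.
move=> aH x0 xy yz sg; have [cH _ _] := aH.
have cf : {within `[x, y], continuous (fun v => H v - v)}.
  by apply: continuous_subspaceT => v; apply: cvgB; [exact: cH|exact: cvg_id].
have [|c] := IVT xy cf (v := 0).
  rewrite /Num.min /Num.max; case: ltP => h; apply/andP; split; nra.
rewrite in_itv /= => /andP[xc cy] /eqP; rewrite subr_eq0 => /eqP Hc.
have ck : c = kappa by apply: attracts_fixed Hc => //; apply/andP; split; lra.
by rewrite -ck xc cy.
Qed.

(** If H x <= x, then H stays below the identity on all of (0, x], since a crossing would put
    [kappa] there; the orbit of [x] is trapped below [x] and cannot reach [kappa]. *)
Lemma attracts_below H x : attracts H -> 0 < x < kappa -> x < H x.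
Proof.
move=> aH /andP[x0 xk]; rewrite ltNge; apply/negP => Hx.
have /andP[_ kz'] := kz; have [_ Hz Hk] := aH.
have xz : 0 < x <= z by apply/andP; split; lra.
have down y : 0 < y <= x -> H y <= y.
  move=> /andP[y0 yx]; rewrite leNgt; apply/negP => Hy.
  have : y <= kappa <= x by apply: (attracts_cross H) => //; [lra|nra].
  by move=> /andP[_]; lra.
have orb n : 0 < iter n H x <= x.
  elim: n => [|n IH]; first by rewrite x0 lexx.
  have := down _ IH; move: IH; rewrite iterS; set y := iter n H x => /andP[y0 yx] Hy.
  have /andP[Hy0 _] : 0 < H y <= z by apply: Hz; apply/andP; split; lra.
  by apply/andP; split; lra.
have : kappa <= x.
  rewrite -(cvg_lim (@Rhausdorff R) (Hk x xz)); apply: limr_le.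
    by apply/cvg_ex; exists kappa; exact: Hk.
  by apply: nearW => n; have /andP[] := orb n.
by move: xk; lra.
Qed.

Lemma attracts_above H x : attracts H -> kappa < x <= z -> H x < x.
Proof.
move=> aH /andP[kx xz]; rewrite ltNge; apply/negP => Hx.
have /andP[k0 kz'] := kz; have [_ Hz Hk] := aH.
have xz' : 0 < x <= z by apply/andP; split; lra.
have up y : x <= y <= z -> y <= H y.
  move=> /andP[xy yz]; rewrite leNgt; apply/negP => Hy.
  have : x <= kappa <= y by apply: (attracts_cross H) => //; [lra|nra].
  by move=> /andP[]; lra.
have orb n : x <= iter n H x <= z.
  elim: n => [|n IH]; first by rewrite lexx xz.
  have := up _ IH; move: IH; rewrite iterS; set y := iter n H x => /andP[xy yz] Hy.
  have /andP[_ Hy0] : 0 < H y <= z by apply: Hz; apply/andP; split; lra.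
  by apply/andP; split; lra.
have : x <= kappa.
  rewrite -(cvg_lim (@Rhausdorff R) (Hk x xz')); apply: limr_ge.
    by apply/cvg_ex; exists kappa; exact: Hk.
  by apply: nearW => n; have /andP[] := orb n.
by move: kx; lra.
Qed.

Lemma attracts_sqr H : attracts H -> attracts (H \o H).
Proof.
move=> [cH Hz Hk]; split => [x|x xz|x xz].
- by apply: continuous_comp; exact: cH.
- exact: (Hz _ (Hz _ xz)).
- have -> : (fun n => iter n (H \o H) x) = (fun n => iter n H x) \o (fun n => n.*2).
    by apply/funext; elim=> //= n; rewrite /= => ->.
  apply: cvg_comp (Hk x xz); apply/cvgnyPge => A; exists A => // n /= An.
  by rewrite -addnn (leq_trans An) // leq_addr.
Qed.

(* An interval [m, M] covered by its own image under a globally attracting map is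
   reduced to the attractor: otherwise some c < kappa satisfies H (H c) <= c,
   although H \o H also attracts to kappa. *)
Lemma attracts_interval H m M a b : attracts H -> H kappa = kappa ->
  0 < m -> m <= a <= M -> m <= b <= M -> M <= z -> H a <= m -> M <= H b ->
  m = kappa /\ M = kappa.
Proof.
move=> aH Hkappa m0 /andP[ma aM] /andP[mb bM] Mz Ham MHb.
have /andP[k0 kz'] := kz; have aHH := attracts_sqr H aH.
have [cH _ _] := aH.
have km : kappa <= m.
  rewrite leNgt; apply/negP => mk.
  have ka : kappa < a.
    rewrite ltNge; apply/negP; rewrite le_eqVlt => /orP[/eqP e|ak].
      by move: Ham; rewrite e Hkappa; lra.
    by have := attracts_below H a aH; rewrite ak andbT => /(_ _); lra.
  have bk : b < kappa.
    rewrite ltNge; apply/negP; rewrite le_eqVlt => /orP[/eqP e|kb].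
      by move: MHb; rewrite -e Hkappa; lra.
    by have := attracts_above H b aH; rewrite kb => /(_ _); lra.
  (* [a] lies between H kappa = kappa and H b >= M, so some [c] in [b, kappa] has H c = a. Then H (H
     c) = H a <= m <= c, against [attracts_below] for the square of [H]. *)
  have [|c] := IVT (ltW bk) (continuous_subspaceT cH) (v := a).
    rewrite /Num.min /Num.max Hkappa; case: ltP => h; apply/andP; split; lra.
  rewrite in_itv /= => /andP[bc ck] Hc.
  have ck' : c < kappa.
    by rewrite lt_neqAle ck andbT; apply/eqP => e; move: Hc; rewrite e Hkappa; lra.
  have := attracts_below _ c aHH; rewrite ck' andbT /= Hc => /(_ _); lra.
have Mk : M <= kappa.
  rewrite leNgt; apply/negP => kM; have : kappa <= b by lra.
  rewrite le_eqVlt => /orP[/eqP e|kb].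
    by move: MHb; rewrite -e Hkappa; lra.
  by have := attracts_above H b aH; rewrite kb => /(_ _); lra.
by split; lra.
Qed.

End Interval.

(** The value is the infimum of the eventual upper bounds. Applied to the opposite function, it also
    supplies the limit inferior. *)
Lemma limsup_pinfty_ex (R : realType) (f : R -> R) (a b : R) : (forall t, a <= f t <= b) ->
  exists s, (forall e, 0 < e -> exists T, forall t, T <= t -> f t <= s + e) /\
    (forall e T, 0 < e -> exists2 t, T <= t & s - e < f t).
Proof.
move=> fab; pose V := [set x | exists T, forall t, T <= t -> f t <= x].
have V0 : V !=set0 by exists b; exists 0 => t _; have /andP[] := fab t.
have Vlb : has_lbound V.
  by exists a => x [T] /(_ T (lexx T)); apply: le_trans; have /andP[] := fab T.
exists (inf V); split=> [e e0|e T e0].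
  have [x [T Tx] xe] := inf_adherent e0 (conj V0 Vlb).
  by exists T => t /Tx fx; lra.
apply: contrapT => H; have : V (inf V - e).
  by exists T => t Tt; rewrite leNgt; apply/negP => ft; apply: H; exists t.
by move=> /(ge_inf Vlb); lra.
Qed.

(** * The semi-wavefront *)

Lemma seq_continuous (R : realType) (f : R -> R) :
  (forall (u : nat -> R) x, u n @[n --> \oo] --> x -> f (u n) @[n --> \oo] --> f x) ->
  continuous f.
Proof.
move=> H x; apply/cvgrPdist_le => e e0; apply: contrapT => nH.
have /choice[u uP] n : exists y, `|x - y| < n.+1%:R^-1 /\ ~ `|f x - f y| <= e.
  apply: contrapT => nh; apply: nH; have i0 : 0 < n.+1%:R^-1 :> R by rewrite invr_gt0.
  apply: filterS (nbhsx_ballx x _ i0) => y; rewrite -ball_normE /= => xy.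
  by apply: contrapT => fxy; apply: nh; exists y.
have ux : u n @[n --> \oo] --> x.
  by apply: cvg_of_inv_bound => n; rewrite distrC; exact: (uP n).1.
have /cvgrPdist_le/(_ e e0)[n _ /(_ n (leqnn n))] := H u x ux.
exact: (uP n).2.
Qed.

Lemma clamp_continuous (R : realType) (lo hi : R) : continuous (clamp R lo hi).
Proof.
move=> x; apply: (@continuous_min R R^o (fun x => Num.max lo x) (cst hi)); last exact: cvg_cst.
by apply: (@continuous_max R R^o (cst lo) id); [exact: cvg_cst|exact: cvg_id].
Qed.

(** Turns continuity of [g] on the half-line into continuity on the whole line, by precomposing with
    a clamp or a positive part. *)
Lemma within_comp_continuous (R : realType) (A : set R) (f c : R -> R) :
  {within A, continuous f} -> continuous c -> (forall x, A (c x)) -> continuous (f \o c).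
Proof.
move=> fA cc Ac x; move=> U /= fU.
have : within A (nbhs (c x)) (f @^-1` U).
  by have := fA (c x) U fU; rewrite /nbhs /= -nbhs_subspace_in //; exact: Ac.
move=> wU; have cU : nbhs x [set y | A (c y) -> U (f (c y))] := cc x _ wU.
suff : nbhs x ((f \o c) @^-1` U) by [].
by apply: (filterS _ cU) => y /= H; exact: H (Ac y).
Qed.

Section Profile.
Context (R : realType) (d : measure_display) (X : measurableType d)
  (mu : {finite_measure set X -> \bar R}).
Variables (K : R -> X -> R) (g : R -> X -> R) (gp : X -> R)
  (tau0 : X) (zeta2 delta lambda eps M : R).
Hypothesis HK0 : forall s tau, 0 <= K s tau.
Hypothesis HKint : ((@lebesgue_measure R) \x mu)%E.-integrable setT
  (fun p : R * X => (K p.1 p.2)%:E).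
Hypothesis HKpos : forall tau, (0 < Kmass K tau)%E.
Hypothesis Hg0 : forall s tau, 0 <= s -> 0 <= g s tau.
Hypothesis Hgmeas : measurable_fun [set p : R * X | 0 <= p.1] (fun p : R * X => g p.1 p.2).
Hypothesis Hgzero : forall tau, g 0 tau = 0.
Hypothesis Hgcont : forall tau, {within `[0, +oo[%classic, continuous (fun v => g v tau)}.
Hypothesis Hgp : forall tau, 0 < gp tau.
Hypothesis HN_meas : measurable [set tau0].
Hypothesis HN_atom : mu [set tau0] = 1%E.
Hypothesis HN_mono : forall tau, tau <> tau0 ->
  {in `[0, +oo[ &, nondecreasing (fun v => g v tau)}.
Hypothesis HN_pos0 : forall v, 0 < v -> 0 < g v tau0.
Hypothesis HN_zeta : 0 < zeta2.
Hypothesis HN_Theta : {in `[0, zeta2] &, {mono Theta mu K g tau0 : u v / u < v}}.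
Hypothesis HN_bound : Theta mu K g tau0 zeta2 >
  fine (Kmass K tau0) * sup [set g v tau0 | v in `[0, +oo[%classic].
Hypothesis Hchi0def : chi_defined mu K gp 0.
Hypothesis Hchi0 : chi mu K gp 0 < 0.
Hypothesis Hsublin : forall s tau, 0 <= s -> g s tau <= gp tau * s.
Hypothesis HL_delta : 0 < delta.
Hypothesis HL_bdd : forall s tau, 0 <= s -> g s tau <= M.
Hypothesis HL_lin : forall s tau, 0 <= s < delta -> g s tau = gp tau * s.
Hypothesis Hlam : 0 < lambda.
Hypothesis Hlamdef : chi_defined mu K gp lambda.
Hypothesis Hlamzero : chi mu K gp lambda = 0.
Hypothesis Heps : 0 < eps.
Hypothesis Hnudef : chi_defined mu K gp (lambda + eps).
Hypothesis Hchinu : 0 < chi mu K gp (lambda + eps).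

(** * The truncated nonlinearity *)

Let ki := kernel_integral mu K.

Lemma measurable_gp : measurable_fun setT gp.
Proof.
have d2 : 0 <= delta / 2 < delta by apply/andP; split; move: HL_delta; lra.
(* Linearity below [delta] expresses the derivative through one section of [g], from which it
   inherits measurability. *)
have -> : gp = fun tau => g (delta / 2) tau / (delta / 2).
  by apply/funext => tau; rewrite HL_lin // mulfK //; apply/eqP; lra.
apply: measurable_funM => //.
have mp : measurable_fun [set: X] (fun tau : X => (delta / 2, tau)).
  by apply: measurable_fun_pair; [exact: measurable_cst|exact: measurable_id].
have mS : measurable [set p : R * X | 0 <= p.1].
  have -> : [set p : R * X | 0 <= p.1] = setT `&` (fst @^-1` `[0, +oo[%classic).
    by apply/seteqP; split => p; rewrite /= in_itv /= andbT => //; case.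
  by apply: measurable_fst => //; exact: measurable_itv.
apply: (measurable_comp mS _ Hgmeas mp) => _ [tau _ <-] /=.
by have /andP[] := d2.
Qed.

(** Clamping at 0 as well gives a function that is bounded, nonnegative and continuous on the whole
    line, as the operator lemmas demand. *)
Definition trunc_g (v : R) (tau : X) : R := g (clamp R 0 zeta2 v) tau.

Lemma clamp0_itv v : 0 <= clamp R 0 zeta2 v <= zeta2.
Proof. exact/clamp_itv/ltW. Qed.

Lemma measurable_trunc_g : measurable_fun setT (fun p : R * X => trunc_g p.1 p.2).
Proof.
have mS : measurable [set p : R * X | 0 <= p.1].
  have -> : [set p : R * X | 0 <= p.1] = setT `&` (fst @^-1` `[0, +oo[%classic).
    by apply/seteqP; split => p; rewrite /= in_itv /= andbT => //; case.
  by apply: measurable_fst => //; exact: measurable_itv.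
have mc : measurable_fun setT (clamp R 0 zeta2).
  exact: continuous_measurable_fun (clamp_continuous R 0 zeta2).
have mp : measurable_fun setT (fun p : R * X => (clamp R 0 zeta2 p.1, p.2)).
  exact: (measurable_fun_pair (measurableT_comp mc measurable_fst) measurable_snd).
apply: (measurable_comp mS _ Hgmeas mp) => _ [p _ <-] /=.
by have /andP[] := clamp0_itv p.1.
Qed.

Lemma trunc_g_itv v tau : 0 <= trunc_g v tau <= M.
Proof.
have /andP[c0 _] := clamp0_itv v.
by rewrite /trunc_g Hg0 // HL_bdd.
Qed.

Lemma trunc_g_continuous tau : continuous (trunc_g^~ tau).
Proof.
apply: (within_comp_continuous _ _ _ _ (Hgcont tau) (clamp_continuous R 0 zeta2)) => v.
by rewrite /= in_itv /= andbT; have /andP[] := clamp0_itv v.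
Qed.

Lemma trunc_gE v tau : 0 <= v <= zeta2 -> trunc_g v tau = g v tau.
Proof. by move=> vz; rewrite /trunc_g clamp_id. Qed.

Lemma clamp_le u v : u <= v -> clamp R 0 zeta2 u <= clamp R 0 zeta2 v.
Proof.
move=> uv; rewrite /clamp le_min !ge_min lexx orbT andbT.
by rewrite ge_max !le_max lexx uv orbT.
Qed.

Lemma trunc_g_le u v tau : tau <> tau0 ->
  clamp R 0 zeta2 u <= clamp R 0 zeta2 v -> trunc_g u tau <= trunc_g v tau.
Proof.
move=> tt uv; apply: HN_mono => //; rewrite in_itv /= andbT.
  by have /andP[] := clamp0_itv u.
by have /andP[] := clamp0_itv v.
Qed.

Lemma trunc_g_sublinear v tau : 0 <= v -> trunc_g v tau <= gp tau * v.
Proof.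
move=> v0; have /andP[c0 _] := clamp0_itv v.
apply: le_trans (Hsublin _ _ c0) _; rewrite ler_pM2l //.
by rewrite /clamp ge_min max_r // lexx.
Qed.

(** * Splitting off the atom, and the map [G] *)

Let i0 : X -> R := \1_[set tau0].
Let i1 : X -> R := \1_(~` [set tau0]).

Let mi0 : measurable_fun setT i0. Proof. exact: measurable_indic. Qed.
Let mi1 : measurable_fun setT i1. Proof. by apply: measurable_indic; exact: measurableC. Qed.

Lemma indic_split tau : i1 tau + i0 tau = 1.
Proof.
rewrite /i0 /i1 !indicE in_setC; case: (_ \in _); rewrite /= ?addr0 ?add0r //.
Qed.

(** Integrability gives finiteness of [Kmass] only almost everywhere; it holds at [tau0] because
    this point has mass 1. *)
Lemma Kmass0_fin : Kmass K tau0 \is a fin_num.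
Proof.
have K0 := Kmass_ge0 K HK0; rewrite ge0_fin_numE //.
have /integrableP[mKm] := Kmass_integrable mu K HK0 HKint; apply: le_lt_trans.
apply: (@le_trans _ _ (\int[mu]_(x in [set tau0]) Kmass K x)%E).
  rewrite (eq_integral (cst (Kmass K tau0))); last by move=> x; rewrite inE => ->.
  rewrite integral_cst // [X in (_ * X)%E](_ : _ = 1%E) ?mule1 //; exact: HN_atom.
under [X in (_ <= X)%E]eq_integral => x _ do rewrite gee0_abs //.
by apply: ge0_subset_integral => //.
Qed.

Let C := fine (Kmass K tau0).

Lemma C_gt0 : 0 < C.
Proof. by rewrite fine_gt0 // HKpos /= -ge0_fin_numE ?Kmass0_fin // Kmass_ge0. Qed.

Lemma ki_atom c : 0 <= c -> ki (fun p => c * i0 p.1) = (c * C)%:E.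
Proof.
move=> c0; have mc : measurable_fun setT (fun tau => c * i0 tau) by exact: measurable_funM.
rewrite /ki (kernel_integral_fst mu K HK0 HKint (fun tau => c * i0 tau)) //; last first.
  by move=> tau; rewrite mulr_ge0 // /i0 indicE.
rewrite (eq_integral ((fun tau => (c * C)%:E) \_ [set tau0])).
  rewrite -integral_mkcond integral_cst // [X in (_ * X)%E](_ : _ = 1%E) ?mule1 //; exact: HN_atom.
move=> tau _; rewrite patchE /i0 indicE; case: ifPn => [|_].
  by rewrite inE => ->; rewrite mulr1 EFinM fineK // Kmass0_fin.
by rewrite mulr0 mul0e.
Qed.

Lemma ki_split (F : X * R -> R) : measurable_fun setT F -> (forall p, 0 <= F p) ->
  ki F = (ki (fun p => (F p * i1 p.1)%R) + ki (fun p => (F p * i0 p.1)%R))%E.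
Proof.
move=> mF F0; rewrite /ki -kernel_integralD //.
- by congr kernel_integral; apply/funext => p; rewrite -mulrDr indic_split mulr1.
- exact: (measurable_funM mF (measurableT_comp mi1 measurable_fst)).
- exact: (measurable_funM mF (measurableT_comp mi0 measurable_fst)).
- by move=> p; rewrite mulr_ge0 // /i1 indicE.
- by move=> p; rewrite mulr_ge0 // /i0 indicE.
Qed.

Let F1 v (p : X * R) : R := trunc_g v p.1 * i1 p.1.

Let mtg v : measurable_fun setT (fun p : X * R => trunc_g v p.1).
Proof. exact: (measurable_comp_fst trunc_g (fun=> v) measurable_trunc_g (measurable_cst v)). Qed.

Let mF1 v : measurable_fun setT (F1 v).
Proof. exact: (measurable_funM (mtg v) (measurableT_comp mi1 measurable_fst)). Qed.

Let F1M v p : 0 <= F1 v p <= M.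
Proof.
have /andP[h0 h1] := trunc_g_itv v p.1; rewrite /F1 /i1 indicE.
by case: (_ \in _); rewrite ?mulr1 ?mulr0 ?h0 ?h1 ?lexx //= (le_trans h0).
Qed.

Definition trunc_gtilde (v : R) : R := fine (ki (F1 v)).

Lemma trunc_gtildeE v : (trunc_gtilde v)%:E = ki (F1 v).
Proof. by rewrite fineK //; apply: (kernel_integral_fin mu K HK0 HKint _ M). Qed.

Lemma gtildeE v : 0 <= v <= zeta2 -> gtilde mu K g tau0 v = trunc_gtilde v.
Proof.
move=> vz; rewrite /gtilde /trunc_gtilde; congr fine.
have mf : measurable_fun setT (fun tau => trunc_g v tau * i1 tau).
  apply: (measurable_funM _ mi1).
  exact: (measurable_fun_pair1 v (mtg v)).
rewrite /ki (kernel_integral_fst mu K HK0 HKint (fun tau => trunc_g v tau * i1 tau)) //; last first.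
  by move=> tau; rewrite mulr_ge0 ?/i1 ?indicE //; have /andP[] := trunc_g_itv v tau.
rewrite integral_mkcond; apply: eq_integral => tau _; rewrite patchE /i1 indicE.
by case: ifPn => _; rewrite ?mulr1 ?mulr0 ?mul0e // trunc_gE.
Qed.

Definition trunc_Theta (v : R) : R := v - trunc_gtilde v.

Lemma ThetaE v : 0 <= v <= zeta2 -> Theta mu K g tau0 v = trunc_Theta v.
Proof. by move=> vz; rewrite /Theta gtildeE. Qed.

Lemma trunc_gtilde_continuous : continuous trunc_gtilde.
Proof.
apply: seq_continuous => u v uv; apply: fine_cvg; rewrite trunc_gtildeE.
apply: (kernel_integral_cvg mu K HK0 HKint _ _ M) => // p.
apply: cvgM; last exact: cvg_cst.
exact: (cvg_comp u (fun v => trunc_g v p.1) uv (trunc_g_continuous p.1 v)).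
Qed.

Lemma trunc_Theta_continuous : continuous trunc_Theta.
Proof. by move=> v; apply: cvgB; [exact: cvg_id|exact: trunc_gtilde_continuous]. Qed.

Lemma trunc_Theta0 : trunc_Theta 0 = 0.
Proof.
rewrite /trunc_Theta /trunc_gtilde /F1 /ki /kernel_integral.
rewrite (eq_integral (cst 0%E)) ?integral0 ?subrr // => p _.
by rewrite trunc_gE ?lexx ?ltW // Hgzero mul0r mulr0.
Qed.

Lemma trunc_Theta_lt u v : 0 <= u <= zeta2 -> 0 <= v <= zeta2 ->
  (trunc_Theta u < trunc_Theta v) = (u < v).
Proof. by move=> uz vz; rewrite -!ThetaE // HN_Theta // in_itv. Qed.

Let gsup := sup [set g v tau0 | v in `[0, +oo[%classic].

Lemma g_le_sup v : 0 <= v -> g v tau0 <= gsup.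
Proof.
move=> v0; apply: ub_le_sup; last by exists v => //; rewrite /= in_itv /= v0.
by exists M => y [w /=]; rewrite in_itv /= andbT => w0 <-; exact: HL_bdd.
Qed.

Lemma gsup_bound : C * gsup < trunc_Theta zeta2.
Proof. by rewrite -ThetaE ?lexx ?ltW. Qed.

Let G := Gmap mu K g tau0 zeta2.

(** The default value of [xget] never occurs: C g(v, tau0) lies between Theta(0) = 0 and
    Theta(zeta2), so the intermediate value theorem gives a preimage. *)
Lemma Gmap_spec v : 0 <= v -> 0 <= G v <= zeta2 /\ trunc_Theta (G v) = C * g v tau0.
Proof.
move=> v0; suff [] : [set w | 0 <= w <= zeta2 /\
    Theta mu K g tau0 w = fine (Kmass K tau0) * g v tau0] (G v).
  by move=> Gz; rewrite ThetaE.
apply: xgetPex.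
have Cg0 : 0 <= C * g v tau0 by rewrite mulr_ge0 ?Hg0 // ltW // C_gt0.
have Cgz : C * g v tau0 < trunc_Theta zeta2.
  by apply: le_lt_trans gsup_bound; rewrite ler_pM2l ?C_gt0 // g_le_sup.
have [|w] := IVT (ltW HN_zeta) (continuous_subspaceT trunc_Theta_continuous) (v := C * g v tau0).
  by rewrite trunc_Theta0 ge_min le_max Cg0 (ltW Cgz) orbT.
by rewrite in_itv /= => wz Tw; exists w; split => //; rewrite ThetaE.
Qed.

(** * The characteristic function as an eigenvalue, and the size of [delta] *)

Lemma chi_integralE z : chi_integral mu K gp z =
  ki (fun p => gp p.1 * expR (- (p.2 * z))).
Proof.
have mF : measurable_fun setT (fun p : X * R => gp p.1 * expR (- (p.2 * z))).
  apply: measurable_funM; first exact: (measurableT_comp measurable_gp measurable_fst).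
  apply: measurableT_comp => //; apply: measurableT_comp => //.
  exact: (measurable_funM measurable_snd (measurable_cst z)).
have F0 (p : X * R) : 0 <= gp p.1 * expR (- (p.2 * z)) by rewrite mulr_ge0 ?expR_ge0 // ltW.
rewrite /ki -(kernel_integral_iterated mu K HK0 HKint _ mF F0).
by apply: eq_integral => tau _; apply: eq_integral => s _; rewrite mulrA.
Qed.

Let mexp z t : measurable_fun setT (fun p : X * R => gp p.1 * expR (z * (t - p.2))).
Proof.
apply: measurable_funM; first exact: (measurableT_comp measurable_gp measurable_fst).
apply: measurableT_comp => //; apply: (measurable_funM (measurable_cst z)).
exact: (measurable_funB (measurable_cst t) measurable_snd).
Qed.

(** Exponentials are eigenfunctions of the linearisation at 0, with eigenvalue 1 - chi(z). *)
Lemma ki_exp z t : chi_defined mu K gp z ->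
  ki (fun p => gp p.1 * expR (z * (t - p.2))) = ((1 - chi mu K gp z) * expR (z * t))%:E.
Proof.
move=> zd; have fin : chi_integral mu K gp z \is a fin_num.
  rewrite ge0_fin_numE //; apply: integral_ge0 => tau _; apply: integral_ge0 => s _.
  by rewrite lee_fin !mulr_ge0 ?expR_ge0 // ltW.
rewrite /chi opprB addrC subrK mulrC EFinM fineK // chi_integralE /ki.
rewrite -kernel_integralZ ?expR_ge0 //; last 2 first.
- rewrite (_ : (fun p : X * R => gp p.1 * expR (- (p.2 * z))) =
    (fun p => gp p.1 * expR (z * (0 - p.2)))); first exact: mexp.
  by apply/funext => p; rewrite sub0r mulrN (mulrC z).
- by move=> p; rewrite mulr_ge0 ?expR_ge0 // ltW.
congr kernel_integral; apply/funext => p.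
by rewrite mulrCA -expRD; congr (_ * expR _); lra.
Qed.

Lemma ki_atom_fun (f : X -> R) : 0 <= f tau0 -> ki (fun p => f p.1 * i0 p.1) = (f tau0 * C)%:E.
Proof.
move=> f0; rewrite -(ki_atom _ f0); congr (ki _); apply/funext => p; rewrite /i0 indicE.
case: (boolP (p.1 \in _)) => [h|_]; last by rewrite !mulr0.
by have := set_mem h => /= ph; rewrite ph.
Qed.

(** Otherwise [g] is linear up to [zeta2], and gtilde(zeta2) + C g(zeta2, tau0) = zeta2 (1 - chi(0))
    exceeds [zeta2], against the lower bound on Theta(zeta2). *)
Lemma delta_le_zeta2 : delta <= zeta2.
Proof.
rewrite leNgt; apply/negP => zd.
have zz : 0 <= zeta2 <= zeta2 by rewrite lexx ltW.
have z0 : 0 <= zeta2 by exact: ltW.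
have gz tau : trunc_g zeta2 tau = gp tau * zeta2 by rewrite trunc_gE // HL_lin // z0.
have E1 : ki (fun p => trunc_g zeta2 p.1) = (zeta2 * (1 - chi mu K gp 0))%:E.
  rewrite EFinM; have := ki_exp 0 0 Hchi0def; rewrite mul0r expR0 mulr1 => <-.
  rewrite /ki -kernel_integralZ //; last by move=> p; rewrite mulr_ge0 ?expR_ge0 // ltW.
  by congr kernel_integral; apply/funext => p; rewrite gz mul0r expR0 mulr1 mulrC.
have E2 : ki (fun p => trunc_g zeta2 p.1) = (trunc_gtilde zeta2 + g zeta2 tau0 * C)%:E.
  rewrite ki_split //; last by move=> p; have /andP[] := trunc_g_itv zeta2 p.1.
  rewrite EFinD trunc_gtildeE (ki_atom_fun (trunc_g zeta2)); last by have /andP[] := trunc_g_itv zeta2 tau0.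
  by rewrite trunc_gE.
have := E1; rewrite E2 => -[] E3.
have := gsup_bound; have := g_le_sup _ z0; rewrite -(ler_pM2l C_gt0) /trunc_Theta => h1 h2.
by move: Hchi0 HN_zeta; nra.
Qed.

(** * Comparison bounds for the truncated operator *)

Let conv := conv_op mu K trunc_g.

Lemma convE phi t : measurable_fun setT phi ->
  (conv phi t)%:E = ki (fun p => trunc_g (phi (t - p.2)) p.1).
Proof. exact: (conv_opE mu K HK0 HKint trunc_g M measurable_trunc_g trunc_g_itv). Qed.

Let mint phi t : measurable_fun setT phi ->
  measurable_fun setT (fun p : X * R => trunc_g (phi (t - p.2)) p.1).
Proof. exact: (measurable_conv_integrand trunc_g measurable_trunc_g). Qed.

Let ge0int phi t (p : X * R) : 0 <= trunc_g (phi (t - p.2)) p.1.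
Proof. by have /andP[] := trunc_g_itv (phi (t - p.2)) p.1. Qed.

Lemma conv_ge0 phi t : 0 <= conv phi t.
Proof. by rewrite fine_ge0 // kernel_integral_ge0. Qed.

Let mtimes (F : X * R -> R) (i : X -> R) : measurable_fun setT F -> measurable_fun setT i ->
  measurable_fun setT (fun p => F p * i p.1).
Proof. by move=> mF mi; exact: (measurable_funM mF (measurableT_comp mi measurable_fst)). Qed.

Let i1E (p : X * R) : (i1 p.1 = 0) \/ (i1 p.1 = 1 /\ p.1 <> tau0).
Proof. by rewrite /i1 indicE; case: (boolP (p.1 \in _)) => [/set_mem /=|_]; [right|left]. Qed.

Let i0E (p : X * R) : (i0 p.1 = 0) \/ (i0 p.1 = 1 /\ p.1 = tau0).
Proof. by rewrite /i0 indicE; case: (boolP (p.1 \in _)) => [/set_mem /=|_]; [right|left]. Qed.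

(** Away from [tau0], monotonicity allows [phi] to be replaced by the constant [S]; at [tau0] only
    the bound [c] on the values of [g] is at hand. Comparison after clamping suffices, since
    [trunc_g] sees nothing else. *)
Lemma conv_upper (phi : R -> R) (S c t : R) : measurable_fun setT phi ->
  (forall s, clamp R 0 zeta2 (phi s) <= clamp R 0 zeta2 S) ->
  (forall s, trunc_g (phi s) tau0 <= c) -> conv phi t <= trunc_gtilde S + C * c.
Proof.
move=> mphi phiS phic; rewrite -lee_fin convE // ki_split //; last exact: mint.
have c0 : 0 <= c by apply: le_trans (phic 0); have /andP[] := trunc_g_itv (phi 0) tau0.
rewrite EFinD trunc_gtildeE (mulrC C) -(ki_atom _ c0); apply: leeD.
  apply: le_kernel_integral => //; first exact: (mtimes _ _ (mint phi t mphi) mi1).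
  - by move=> p; rewrite mulr_ge0 // /i1 indicE.
  - move=> p; rewrite /F1; case: (i1E p) => [->|[-> pt]]; first by rewrite !mulr0.
    by rewrite !mulr1; exact: trunc_g_le.
apply: le_kernel_integral => //.
- exact: (mtimes _ _ (mint phi t mphi) mi0).
- exact: (mtimes (fun=> c) _ (measurable_cst c) mi0).
- by move=> p; rewrite mulr_ge0 // /i0 indicE.
- move=> p; case: (i0E p) => [->|[-> ->]]; first by rewrite !mulr0.
  by rewrite !mulr1.
Qed.

Lemma conv_lower (phi : R -> R) (S c t : R) : measurable_fun setT phi ->
  (forall s, clamp R 0 zeta2 S <= clamp R 0 zeta2 (phi s)) ->
  (forall s, c <= trunc_g (phi s) tau0) -> 0 <= c -> trunc_gtilde S + C * c <= conv phi t.
Proof.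
move=> mphi phiS phic c0; rewrite -lee_fin convE // ki_split //; last exact: mint.
rewrite EFinD trunc_gtildeE (mulrC C) -(ki_atom _ c0); apply: leeD.
  apply: le_kernel_integral => //; first exact: (mtimes _ _ (mint phi t mphi) mi1).
  - by move=> p; have /andP[] := F1M S p.
  - move=> p; rewrite /F1; case: (i1E p) => [->|[-> pt]]; first by rewrite !mulr0.
    by rewrite !mulr1; exact: trunc_g_le.
apply: le_kernel_integral => //.
- exact: (mtimes (fun=> c) _ (measurable_cst c) mi0).
- exact: (mtimes _ _ (mint phi t mphi) mi0).
- by move=> p; rewrite mulr_ge0 // /i0 indicE.
- move=> p; case: (i0E p) => [->|[-> ->]]; first by rewrite !mulr0.
  by rewrite !mulr1.
Qed.

Lemma conv_bound phi t : measurable_fun setT phi ->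
  conv phi t <= trunc_gtilde zeta2 + C * gsup.
Proof.
move=> mphi; apply: conv_upper => // s.
  have /andP[_ cz] := clamp0_itv (phi s); apply: le_trans cz _.
  by rewrite clamp_id // lexx ltW.
by rewrite /trunc_g; apply: g_le_sup; have /andP[] := clamp0_itv (phi s).
Qed.

Lemma conv_bound_lt : trunc_gtilde zeta2 + C * gsup < zeta2.
Proof. by have := gsup_bound; rewrite /trunc_Theta; lra. Qed.

(** * Super- and subsolutions, and the fixed point between them *)

Let pm := phi_minus delta lambda eps.
Let pp := phi_plus delta lambda.

Lemma phi_minusE t : pm t = Num.max (delta * expR (lambda * t) * (1 - expR (eps * t))) 0.
Proof.
rewrite /pm /phi_minus; have D : 0 <= delta * expR (lambda * t) by rewrite mulr_ge0 ?expR_ge0 // ltW.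
case: ifPn => t0.
  by rewrite max_l // mulr_ge0 // subr_ge0 -expR0 ler_expR pmulr_rle0.
rewrite max_r // mulr_ge0_le0 // subr_le0 -expR0 ler_expR pmulr_rge0 //.
by rewrite ltW // ltNge.
Qed.

Lemma phi_minus_pos t : 0 < t -> pm t = 0.
Proof. by move=> t0; rewrite /pm /phi_minus leNgt t0. Qed.

Lemma phi_minus_ge0 t : 0 <= pm t.
Proof. by rewrite phi_minusE le_max lexx orbT. Qed.

Lemma phi_plus_ge0 t : 0 <= pp t.
Proof. by rewrite mulr_ge0 ?expR_ge0 // ltW. Qed.

Lemma phi_minus_le_plus t : pm t <= pp t.
Proof.
rewrite phi_minusE ge_max phi_plus_ge0 andbT /pp /phi_plus ler_piMr //.
  exact: phi_plus_ge0.
Qed.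

Lemma phi_plus_homo : {homo pp : s t / s <= t}.
Proof. by move=> s t st; rewrite ler_pM2l // ler_expR ler_pM2l. Qed.

Lemma phi_minus_lt_delta t : t < 0 -> pp t < delta.
Proof. by move=> t0; rewrite /pp /phi_plus gtr_pMr // -expR0 ltr_expR pmulr_rlt0. Qed.

Lemma phi_minus_le_delta t : pm t <= delta.
Proof.
have [t0|t0] := leP t 0; last by rewrite phi_minus_pos // ltW.
apply: le_trans (phi_minus_le_plus t) _; apply: le_trans (phi_plus_homo _ _ t0) _.
by rewrite /pp /phi_plus mulr0 expR0 mulr1.
Qed.

(** Sublinearity bounds the operator by its linearisation, which reproduces [pp] because chi(lambda)
    = 0. *)
Lemma conv_le_phi_plus (phi : R -> R) (t : R) : measurable_fun setT phi ->
  (forall s, 0 <= phi s <= pp s) -> conv phi t <= pp t.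
Proof.
move=> mphi phip; rewrite -lee_fin convE //.
have -> : (pp t)%:E = ki (fun p => delta * (gp p.1 * expR (lambda * (t - p.2)))).
  rewrite /ki kernel_integralZ ?(ltW HL_delta) //; last first.
    by move=> p; rewrite mulr_ge0 ?expR_ge0 // ltW.
  by rewrite -/ki ki_exp // Hlamzero subr0 mul1r.
apply: le_kernel_integral => //.
- exact: mint.
- exact: (measurable_funM (measurable_cst delta) (mexp lambda t)).
- move=> p; have /andP[h0 h1] := phip (t - p.2).
  apply: le_trans (trunc_g_sublinear _ _ h0) _.
  by rewrite mulrCA ler_pM2l.
Qed.

(** The times [t] and [u] are kept apart so that translates of [phi_minus] are covered. The
    linearisation fixes the [lambda] exponential and multiplies the one subtracted from it by 1 -
    chi(lambda + eps) < 1, so the difference can only grow. *)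
Lemma conv_ge_phi_minus (phi : R -> R) (t u c : R) : measurable_fun setT phi -> 0 <= c ->
  (forall s tau, gp tau * (c * pm (u - s)) <= trunc_g (phi (t - s)) tau) ->
  c * pm u <= conv phi t.
Proof.
move=> mphi c0 H; have [u0|u0] := leP u 0; last first.
  by rewrite phi_minus_pos // mulr0 conv_ge0.
pose E z (p : X * R) := gp p.1 * expR (z * (u - p.2)).
have E0 z p : 0 <= E z p by rewrite mulr_ge0 ?expR_ge0 // ltW.
have cd0 : 0 <= c * delta by rewrite mulr_ge0 // ltW.
have mE z : measurable_fun setT (fun p => c * delta * E z p).
  exact: (measurable_funM (measurable_cst (c * delta)) (mexp z u)).
(* The subtracted exponential is moved to the right-hand side because [kernel_integralD] handles
   nonnegative functions only. *)
have : (ki (fun p => (c * delta * E lambda p)%R) <=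
    ki (fun p => (trunc_g (phi (t - p.2)) p.1 + c * delta * E (lambda + eps) p)%R))%E.
  apply: le_kernel_integral => //.
  - exact: (measurable_funD (mint phi t mphi) (mE _)).
  - by move=> p; rewrite mulr_ge0.
  - move=> p; rewrite -lerBlDr; apply: le_trans (H p.2 p.1).
    have -> : c * delta * E lambda p - c * delta * E (lambda + eps) p =
      gp p.1 * (c * (delta * expR (lambda * (u - p.2)) * (1 - expR (eps * (u - p.2))))).
      by rewrite /E mulrDl expRD; ring.
    by rewrite ler_pM2l // ler_wpM2l // phi_minusE le_max lexx.
rewrite /ki kernel_integralD //; [|exact: mint|by move=> p; rewrite mulr_ge0].
rewrite !kernel_integralZ //; [|exact: mexp|exact: mexp].
rewrite -/ki !ki_exp // -convE // Hlamzero -!EFinM -EFinD lee_fin subr0 mul1r.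
rewrite /pm /phi_minus u0 (mulrDl lambda eps u) expRD => h.
have := expR_ge0 (lambda * u); have := expR_ge0 (eps * u).
move: (expR _) (expR _) h => e1 e2 h e20 e10.
have : 0 <= c * delta * (chi mu K gp (lambda + eps) * (e1 * e2)).
  by rewrite !mulr_ge0 // ltW.
by move: h; nra.
Qed.

(** Below delta/2, [g] is linear. Above it, monotonicity bounds [g] off the atom by its value at
    delta/2, whence theta <= 1/2; at [tau0] the positive minimum of [g] on [delta/2, zeta2] takes
    over, whence the second bound on [theta]. *)
Lemma ex_theta : exists theta, [/\ 0 < theta, theta <= 1 &
  forall v tau, 0 <= v -> gp tau * Num.min v (theta * delta) <= trunc_g v tau].
Proof.
have dz := delta_le_zeta2; have d0 := HL_delta; pose h := delta / 2.
have h0 : 0 < h by rewrite divr_gt0.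
have hd : h < delta by rewrite /h; lra.
have hz : h <= zeta2 by lra.
have [c ch cmin] := EVT_min hz (continuous_subspaceT (trunc_g_continuous tau0)).
have c0 : 0 < trunc_g c tau0.
  move: ch; rewrite in_itv /= => /andP[hc cz].
  by rewrite trunc_gE ?HN_pos0 ?cz ?andbT; lra.
have gd0 : 0 < gp tau0 * delta by rewrite mulr_gt0.
pose theta := Num.min (1 / 2) (trunc_g c tau0 / (gp tau0 * delta)).
have th2 : theta <= 1 / 2 by rewrite /theta ge_min lexx.
exists theta; split; first by rewrite lt_min divr_gt0 //= divr_gt0.
  by lra.
move=> v tau v0; have min1 : Num.min v (theta * delta) <= v by rewrite ge_min lexx.
have min2 : Num.min v (theta * delta) <= theta * delta by rewrite ge_min lexx orbT.
have [vh|hv] := ltP v h.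
  by rewrite trunc_gE ?v0 /= ?HL_lin ?v0 /=; [rewrite ler_pM2l|lra|lra].
have [->|tt] := pselect (tau = tau0).
  have /andP[cl0 clz] := clamp0_itv v.
  have -> : trunc_g v tau0 = trunc_g (clamp R 0 zeta2 v) tau0.
    by rewrite /trunc_g (clamp_id R 0 zeta2 (clamp R 0 zeta2 v)) // cl0.
  apply: (@le_trans _ _ (trunc_g c tau0)); last first.
    by apply: cmin; rewrite in_itv /= clz andbT /clamp le_min hz andbT le_max hv orbT.
  apply: (@le_trans _ _ (gp tau0 * (theta * delta))); first by rewrite ler_pM2l.
  have : theta <= trunc_g c tau0 / (gp tau0 * delta) by rewrite /theta ge_min lexx orbT.
  by rewrite ler_pdivlMr // mulrCA.
apply: (@le_trans _ _ (trunc_g h tau)); last by apply: trunc_g_le => //; exact: clamp_le.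
rewrite trunc_gE ?HL_lin ?hd ?hz ?(ltW h0) // ler_pM2l //.
by apply: le_trans min2 _; rewrite /h; nra.
Qed.

(* Besides [phi_minus], the invariant order interval is bounded below by the
   running supremum of [theta * phi_minus], again a subsolution because all
   translates of [phi_minus] are: this keeps the fixed point away from 0 at
   +oo. *)
Lemma ex_fixed_profile : exists (phi : R -> R) (eta : R),
  [/\ measurable_fun setT phi, forall t, pm t <= phi t <= pp t,
      forall t, conv phi t = phi t, 0 < eta & forall t, -1 <= t -> eta <= phi t].
Proof.
have [theta [th0 th1 thP]] := ex_theta.
pose runsup t := sup [set theta * pm u | u in [set u | u <= t]].
have pmd u : theta * pm u <= delta.
  by apply: le_trans (phi_minus_le_delta u); rewrite ler_piMl // phi_minus_ge0.
have rs_ub t u : u <= t -> theta * pm u <= runsup t.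
  by move=> ut; apply: ub_le_sup; [exists delta => _ [w _ <-]|exists u].
have rs_le t x : (forall u, u <= t -> theta * pm u <= x) -> runsup t <= x.
  move=> H; apply: ge_sup; first by exists (theta * pm t); exists t => //=.
  by move=> _ [u /= ut <-]; exact: H.
pose lo t := Num.max (pm t) (runsup t).
have mE (a : R) : measurable_fun setT (fun t : R => expR (a * t)).
  apply: measurableT_comp => //; exact: (measurable_funM (measurable_cst a) measurable_id).
have mpp : measurable_fun setT pp by exact: (measurable_funM (measurable_cst delta) (mE lambda)).
have mpm : measurable_fun setT pm.
  have -> : pm = (fun t => Num.max (delta * expR (lambda * t) * (1 - expR (eps * t))) 0).
    by apply/funext => t; exact: phi_minusE.
  have m1 := measurable_funB (measurable_cst (1 : R)) (mE eps).
  exact: (measurable_maxr (measurable_funM mpp m1) (measurable_cst (0 : R))).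
have mlo : measurable_fun setT lo.
  apply: (measurable_maxr mpm); apply: nondecreasing_measurable => // s t st.
  by apply: rs_le => u us; apply: rs_ub; exact: le_trans st.
have lopp t : lo t <= pp t.
  rewrite /lo ge_max phi_minus_le_plus; apply: rs_le => u ut.
  apply: le_trans (phi_plus_homo _ _ ut); apply: le_trans (phi_minus_le_plus u).
  by rewrite ler_piMl // phi_minus_ge0.
have inv phi : order_interval R lo pp phi -> forall t, lo t <= conv phi t <= pp t.
  move=> [mphi phiI] t.
  have philo s : pm s <= phi s by have /andP[+ _] := phiI s; rewrite /lo ge_max => /andP[].
  have phirs s : runsup s <= phi s by have /andP[+ _] := phiI s; rewrite /lo ge_max => /andP[].
  have phi0 s : 0 <= phi s by apply: le_trans (philo s); exact: phi_minus_ge0.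
  have phipp s : phi s <= pp s by have /andP[] := phiI s.
  apply/andP; split; last first.
    by apply: conv_le_phi_plus => // s; rewrite phi0 phipp.
  rewrite /lo ge_max; apply/andP; split.
    rewrite -[pm t]mul1r; apply: conv_ge_phi_minus => // s tau; rewrite mul1r.
    have [ts|st] := leP 0 (t - s).
      have -> : pm (t - s) = 0.
        move: ts; rewrite le_eqVlt => /orP[/eqP <-|/phi_minus_pos //].
        by rewrite phi_minusE !mulr0 expR0 subrr mulr0 maxxx.
      by rewrite mulr0; have /andP[] := trunc_g_itv (phi (t - s)) tau.
    (* At negative times the upper barrier is below [delta], so [g] is exactly linear there; at the
       other times [pm] vanishes. *)
    have pd : phi (t - s) < delta by apply: le_lt_trans (phipp _) _; exact: phi_minus_lt_delta.
    rewrite trunc_gE; first by rewrite HL_lin ?phi0 // ler_pM2l.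
    by rewrite phi0 (le_trans (ltW pd)) // delta_le_zeta2.
  (* For u <= t, the translate [theta * pm (u - s)] is one of the values below [runsup (t - s)],
     hence below [phi (t - s)], and it never exceeds [theta * delta]; [ex_theta] then gives the
     linear lower bound. *)
  apply: rs_le => u ut; apply: conv_ge_phi_minus => //; first exact: ltW.
  move=> s tau; apply: le_trans (thP _ tau (phi0 (t - s))); rewrite ler_pM2l // le_min.
  rewrite ler_pM2l // phi_minus_le_delta andbT.
  by apply: le_trans (phirs (t - s)); apply: rs_ub; rewrite lerD2r.
have equi : equicontinuous_family (conv @` order_interval R lo pp).
  move=> t e e0; have [r r0 rP] := conv_op_equicontinuous mu K HK0 HKint trunc_g M
    measurable_trunc_g trunc_g_itv t e e0.
  by exists r => // _ t' [phi [mphi _] <-] tt'; exact: rP.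
have cont (u : nat -> R -> R) f : (forall n, order_interval R lo pp (u n)) ->
    order_interval R lo pp f -> (forall t, u n t @[n --> \oo] --> f t) ->
    forall t, conv (u n) t @[n --> \oo] --> conv f t.
  move=> Iu [mf _] uf t; apply: (conv_op_cvg mu K HK0 HKint trunc_g M
    measurable_trunc_g trunc_g_itv) => //; first exact: trunc_g_continuous.
  by move=> n; exact: (Iu n).1.
have [phi [mphi phiI] phifix] := order_interval_fixpoint R lo pp conv mlo mpp lopp inv equi cont.
(* Any negative time would serve as well as -1: [pm] is positive there, and the running supremum
   retains that value afterwards. *)
exists phi, (theta * pm (-1)); split => //.
- by move=> t; have /andP[+ ->] := phiI t; rewrite /lo ge_max => /andP[-> _].
- rewrite mulr_gt0 // phi_minusE lt_max; apply/orP; left.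
  apply: mulr_gt0; first by rewrite mulr_gt0 ?expR_gt0.
  by rewrite subr_gt0 -[X in _ < X]expR0 ltr_expR mulrN1 oppr_lt0.
- move=> t t1; have /andP[+ _] := phiI t; rewrite /lo ge_max => /andP[_].
  by apply: le_trans; exact: rs_ub.
Qed.

(** * Behaviour of the profile near plus infinity *)

Lemma conv_shift (phi : R -> R) (a t : R) : conv (fun s => phi (a + s)) t = conv phi (a + t).
Proof.
by rewrite /conv /conv_op; congr (fine (kernel_integral _ _ _)); apply/funext => p; rewrite addrA.
Qed.

(** Translates of a fixed point are again fixed points, so they lie in the image of [conv], which is
    bounded and equicontinuous; a pointwise limit is fixed because [conv] respects pointwise
    convergence. *)
Lemma limit_profile (phi : R -> R) (tn : nat -> R) : measurable_fun setT phi ->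
  (forall t, conv phi t = phi t) -> (forall n, n%:R <= tn n) ->
  exists (psi : R -> R) (k : nat -> nat), [/\ measurable_fun setT psi,
    forall t, conv psi t = psi t, forall n, (n <= k n)%N &
    forall t, phi (tn (k n) + t) @[n --> \oo] --> psi t].
Proof.
move=> mphi phifix tn_ge; pose u n t := phi (tn n + t).
have mu' n : measurable_fun setT (u n).
  have mt : measurable_fun setT (fun t : R => tn n + t).
    by apply: measurable_funD; [exact: measurable_cst|exact: measurable_id].
  exact: (measurableT_comp mphi mt).
have ufix n t : conv (u n) t = u n t by rewrite conv_shift phifix.
have equi : equicontinuous_family (conv @` [set f | measurable_fun setT f]).
  move=> t e e0; have [r r0 rP] := conv_op_equicontinuous mu K HK0 HKint trunc_g M
    measurable_trunc_g trunc_g_itv t e e0.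
  by exists r => // _ t' [f mf <-] tt'; exact: rP.
have uE n : (conv @` [set f | measurable_fun setT f]) (u n).
  by exists (u n); [exact: mu'|apply/funext => t].
have ub n t : 0 <= u n t <= trunc_gtilde zeta2 + C * gsup.
  by rewrite -ufix conv_ge0 conv_bound.
have [psi [k [_ kn psiu]]] := equicontinuous_subsequence R _ u (fun=> 0)
  (fun=> trunc_gtilde zeta2 + C * gsup) equi uE ub.
have mpsi : measurable_fun setT psi.
  by apply: (@measurable_fun_cvg _ _ R setT (fun n => u (k n))) => [n|t _]; [exact: mu'|exact: psiu].
exists psi, k; split => // t.
have h1 := conv_op_cvg mu K HK0 HKint trunc_g M measurable_trunc_g trunc_g_itv
  (fun n => u (k n)) psi t trunc_g_continuous (fun n => mu' (k n)) mpsi psiu.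
have h2 : conv (u (k n)) t @[n --> \oo] --> psi t.
  by under eq_cvg do rewrite ufix; exact: psiu.
by rewrite -(cvg_lim (@Rhausdorff R) h2); apply/esym/cvg_lim => //; exact: h1.
Qed.

Lemma limit_le (f : nat -> R) (l s : R) (k : nat -> nat) :
  (forall n, (n <= k n)%N) -> f n @[n --> \oo] --> l ->
  (forall e, 0 < e -> exists T : R, forall n, T <= (k n)%:R -> f n <= s + e) -> l <= s.
Proof.
move=> kn fl H; apply/ler_addgt0Pr => e e0; have [T TP] := H e e0.
apply: (cvgr_to_le fl); have := nbhs_infty_ge (Num.truncn `|T|).+1.
apply: filterS => n /= Tn; apply: TP.
have /andP[_ /ltW h] := truncn_itv (normr_ge0 T).
apply: le_trans (ler_norm T) _; apply: le_trans h _.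
by rewrite ler_nat (leq_trans Tn).
Qed.

Lemma Gmap_le S b : 0 <= S <= zeta2 -> 0 <= b -> trunc_Theta S <= C * g b tau0 -> S <= G b.
Proof.
move=> Sz b0 h; have [Gz GE] := Gmap_spec b b0.
by rewrite leNgt -trunc_Theta_lt // GE -leNgt.
Qed.

Lemma Gmap_ge S b : 0 <= S <= zeta2 -> 0 <= b -> C * g b tau0 <= trunc_Theta S -> G b <= S.
Proof.
move=> Sz b0 h; have [Gz GE] := Gmap_spec b b0.
by rewrite leNgt -trunc_Theta_lt // GE -leNgt.
Qed.

(** [attracts] asks for continuity on the whole line; this extension agrees with [G] on nonnegative
    arguments. *)
Let Gbar (v : R) := G (Num.max v 0).

Lemma Gbar_continuous : continuous Gbar.
Proof.
have gc : continuous (fun v : R => C * g (Num.max v 0) tau0).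
  move=> v; apply: cvgM; first exact: cvg_cst.
  have mc : continuous (fun v : R => Num.max v 0).
    by move=> w; apply: (@continuous_max R R^o id (cst 0)); [exact: cvg_id|exact: cvg_cst].
  apply: (within_comp_continuous _ _ _ _ (Hgcont tau0) mc) => w.
  by rewrite /= in_itv /= andbT le_max lexx orbT.
move=> v; apply/cvgrPdist_lt => e e0.
have max0 (w : R) : 0 <= Num.max w 0 by rewrite le_max lexx orbT.
have [/andP[w0 wz] wE] := Gmap_spec _ (max0 v); rewrite -/(Gbar v) in w0 wz wE.
(* Continuity of the inverse of [trunc_Theta]: its strict inequality at [Gbar v + e] persists near
   [v], unless that point is beyond [zeta2], where there is nothing to prove. *)
have up : \forall y \near v, Gbar y < Gbar v + e.
  have [wez|wez] := leP (Gbar v + e) zeta2; last first.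
    apply: (@nearW _ (nbhs v)) => y; have [/andP[_ yz] _] := Gmap_spec _ (max0 y).
    by apply: le_lt_trans yz wez.
  have : C * g (Num.max v 0) tau0 < trunc_Theta (Gbar v + e).
    by rewrite -wE trunc_Theta_lt ?w0 ?wz //; [rewrite ltrDl|apply/andP; split; lra].
  move=> /(cvgr_lt _ (gc v)); apply: filterS => y hy.
  have [yz yE] := Gmap_spec _ (max0 y).
  by move: hy; rewrite -yE trunc_Theta_lt //; apply/andP; split; lra.
have down : \forall y \near v, Gbar v - e < Gbar y.
  have [wez|wez] := leP 0 (Gbar v - e); last first.
    apply: (@nearW _ (nbhs v)) => y; have [/andP[y0 _] _] := Gmap_spec _ (max0 y).
    by apply: lt_le_trans wez y0.
  have : trunc_Theta (Gbar v - e) < C * g (Num.max v 0) tau0.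
    by rewrite -wE trunc_Theta_lt ?w0 ?wz //; [rewrite gtrBl|apply/andP; split; lra].
  move=> /(cvgr_gt _ (gc v)); apply: filterS => y hy.
  have [yz yE] := Gmap_spec _ (max0 y).
  by move: hy; rewrite -yE trunc_Theta_lt //; apply/andP; split; lra.
apply: filterS (filterI up down) => y [h1 h2].
by rewrite ltr_norml; apply/andP; split; lra.
Qed.

Lemma Gmap_gt0 v : 0 < v -> 0 < G v.
Proof.
move=> v0; have [Gz GE] := Gmap_spec v (ltW v0).
have z00 : ((0 : R) <= 0) && (0 <= zeta2) by rewrite lexx ltW.
by rewrite -trunc_Theta_lt // trunc_Theta0 GE mulr_gt0 ?C_gt0 ?HN_pos0.
Qed.

Lemma profile_limit (phi : R -> R) (eta kappa : R) : measurable_fun setT phi ->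
  (forall t, conv phi t = phi t) -> 0 < eta -> (forall t, -1 <= t -> eta <= phi t) ->
  kappa <> 0 -> [set s | 0 <= s /\ G s = s] = [set 0; kappa] ->
  (forall s, 0 < s <= zeta2 -> iter n G s @[n --> \oo] --> kappa) ->
  phi t @[t --> +oo] --> kappa.
Proof.
move=> mphi phifix eta0 phieta kappa0 fixG attrG.
have [k0 Gk] : 0 <= kappa /\ G kappa = kappa.
  suff : [set s | 0 <= s /\ G s = s] kappa by [].
  by rewrite fixG; right.
have kgt0 : 0 < kappa by rewrite lt_neqAle k0 andbT eq_sym; apply/eqP.
have kz : 0 < kappa <= zeta2.
  by rewrite kgt0 -Gk; have [/andP[]] := Gmap_spec _ k0.
have GbarE v : 0 <= v -> Gbar v = G v by move=> v0; rewrite /Gbar max_l.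
have aG : attracts R zeta2 kappa Gbar.
  split => [|x /andP[x0 xz]|x xz]; first exact: Gbar_continuous.
    rewrite GbarE ?(ltW x0) // Gmap_gt0 //.
    by have [/andP[]] := Gmap_spec _ (ltW x0).
  have -> : (fun n => iter n Gbar x) = (fun n => iter n G x); last exact: attrG.
  apply/funext => n; suff [-> _] : iter n Gbar x = iter n G x /\ 0 < iter n G x by [].
  elim: n => [|n [IH IH0]] /=; first by have /andP[] := xz.
  by rewrite IH GbarE ?(ltW IH0) //; split => //; exact: Gmap_gt0.
have phib t : 0 <= phi t <= trunc_gtilde zeta2 + C * gsup.
  by rewrite -phifix conv_ge0 conv_bound.
have bz := conv_bound_lt.
have [S [Sup Sad]] := limsup_pinfty_ex R phi _ _ phib.
have nphib t : - (trunc_gtilde zeta2 + C * gsup) <= - phi t <= - 0.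
  by have /andP[? ?] := phib t; rewrite !lerN2; apply/andP.
have [m' [mup mad]] := limsup_pinfty_ex R (fun t => - phi t) _ _ nphib.
pose m := - m'.
have m0 : eta <= m.
  apply/ler_addgt0Pr => e e0; have [t t1] := mad e (-1) e0.
  by have := phieta t t1; rewrite /m; lra.
have Sz : S <= zeta2.
  apply/ler_addgt0Pr => e e0; have [t _] := Sad e 0 e0.
  by have /andP[_] := phib t; lra.
have mS : m <= S.
  apply/ler_addgt0Pr => e e0; have e20 : 0 < e / 2 by rewrite divr_gt0.
  have [T1 T1P] := Sup _ e20; have [T2 T2P] := mup _ e20.
  have := T1P (Num.max T1 T2); have := T2P (Num.max T1 T2).
  by rewrite !le_max !lexx orbT => /(_ isT) h1 /(_ isT) h2; rewrite /m; lra.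
have mpos : 0 < m by exact: lt_le_trans eta0 m0.
have limit_itv psi (tn : nat -> R) k : (forall n, n%:R <= tn n) -> (forall n, (n <= k n)%N) ->
    (forall t, phi (tn (k n) + t) @[n --> \oo] --> psi t) -> forall t, m <= psi t <= S.
  move=> tn_ge kn psiu t; apply/andP; split.
    rewrite -lerN2; apply: (limit_le _ _ _ k kn (cvgN (psiu t))) => e e0.
    have [T TP] := mup e e0; exists (T - t) => n Tn; rewrite /m opprK.
    by apply: TP; have := tn_ge (k n); lra.
  apply: (limit_le _ _ _ k kn (psiu t)) => e e0.
  have [T TP] := Sup e e0; exists (T - t) => n Tn.
  by apply: TP; have := tn_ge (k n); lra.
have tgc : {within `[m, S], continuous (trunc_g^~ tau0)}.
  exact: continuous_subspaceT (trunc_g_continuous tau0).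
have mSz v : m <= v <= S -> 0 <= v <= zeta2 by move=> /andP[? ?]; apply/andP; split; lra.
have itvS : m <= S <= S by rewrite mS lexx.
have itvm : m <= m <= S by rewrite mS lexx.
have [b bI SGb] : exists2 b, m <= b <= S & S <= G b.
  have /choice[tn tnP] n : exists t, n%:R <= t /\ S - n.+1%:R^-1 < phi t.
    by have [|t ? ?] := Sad n.+1%:R^-1 n%:R; [rewrite invr_gt0|exists t].
  have [psi [k [mpsi psifix kn psiu]]] := limit_profile phi tn mphi phifix (fun n => (tnP n).1).
  have psiI := limit_itv psi tn k (fun n => (tnP n).1) kn psiu.
  have psi0 : psi 0 = S.
    apply/eqP; rewrite eq_le; have /andP[_ ->] := psiI 0 => /=.
    rewrite -lerN2; apply: (limit_le _ _ _ k kn (cvgN (psiu 0))) => e e0.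
    (* Once [k n] is at least 1/e, the slack 1/(k n + 1) in the choice of [tn] is at most [e]. *)
    exists (e^-1) => n ne; have := (tnP (k n)).2; rewrite addr0.
    have : (k n).+1%:R^-1 <= e.
      rewrite invf_ple ?posrE //; apply: le_trans ne _; by rewrite ler_nat.
    by move: (_%:R^-1) (phi _) => q p h1 h2; lra.
  have [c] := EVT_max mS tgc; rewrite in_itv /= => cI cmax.
  exists c => //; apply: Gmap_le; [exact: mSz|by have /andP[] := mSz c cI|].
  rewrite -trunc_gE; last exact: mSz.
  (* S = psi(0) = conv psi 0 is at most gtilde(S) + C g(c, tau0), where [c] maximises [g] at [tau0]
     over [m, S]; hence Theta(S) <= C g(c, tau0) and S <= G(c). *)
  rewrite /trunc_Theta lerBlDl -{1}psi0 -psifix; apply: conv_upper => // s.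
    by apply: clamp_le; have /andP[] := psiI s.
  by apply: cmax; rewrite in_itv /= psiI.
have [a aI Gam] : exists2 a, m <= a <= S & G a <= m.
  have /choice[tn tnP] n : exists t, n%:R <= t /\ m' - n.+1%:R^-1 < - phi t.
    by have [|t ? ?] := mad n.+1%:R^-1 n%:R; [rewrite invr_gt0|exists t].
  have [psi [k [mpsi psifix kn psiu]]] := limit_profile phi tn mphi phifix (fun n => (tnP n).1).
  have psiI := limit_itv psi tn k (fun n => (tnP n).1) kn psiu.
  have psi0 : psi 0 = m.
    apply/eqP; rewrite eq_le; have /andP[-> _] := psiI 0; rewrite andbT.
    apply: (limit_le _ _ _ k kn (psiu 0)) => e e0.
    exists (e^-1) => n ne; have := (tnP (k n)).2; rewrite addr0.
    have : (k n).+1%:R^-1 <= e.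
      rewrite invf_ple ?posrE //; apply: le_trans ne _; by rewrite ler_nat.
    by rewrite /m; move: (_%:R^-1) (phi _) => q p h1 h2; lra.
  have [c] := EVT_min mS tgc; rewrite in_itv /= => cI cmin.
  exists c => //; apply: Gmap_ge; [exact: mSz|by have /andP[] := mSz c cI|].
  rewrite -trunc_gE; last exact: mSz.
  rewrite /trunc_Theta lerBrDl -{2}psi0 -psifix; apply: conv_lower => //.
  - by move=> s; apply: clamp_le; have /andP[] := psiI s.
  - by move=> s; apply: cmin; rewrite in_itv /= psiI.
  - by have /andP[] := trunc_g_itv c tau0.
have Gbk : Gbar kappa = kappa by rewrite GbarE.
have /andP[a0 _] := mSz a aI; have /andP[b0 _] := mSz b bI.
have [mk Sk] : m = kappa /\ S = kappa.
  by apply: (attracts_interval R zeta2 kappa kz Gbar m S a b) => //; rewrite GbarE.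
apply/cvgrPdist_le => e e0; have [T1 T1P] := Sup e e0; have [T2 T2P] := mup e e0.
have := nbhs_pinfty_ge (num_real (Num.max T1 T2)); apply: filterS => t.
rewrite ge_max => /andP[/T1P h1 /T2P h2].
by move: mk; rewrite /m => mk; rewrite ler_norml; apply/andP; split; lra.
Qed.

(** The operator bound [conv_bound] is strictly below [zeta2], so it gives the supremum estimate and
    at the same time shows that the truncation is inactive along [phi]. *)
Lemma profile_exists : exists phi : R -> R,
  frakK delta lambda eps (lambda + eps) phi /\
  (forall t, Aop mu K g phi t = (phi t)%:E) /\
  (has_ubound (range phi) /\ sup (range phi) < zeta2) /\
  (forall kappa : R, kappa <> 0 ->
     [set s | 0 <= s /\ G s = s] = [set 0; kappa] ->
     (forall s, 0 < s <= zeta2 -> iter n G s @[n --> \oo] --> kappa) ->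
     phi t @[t --> +oo] --> kappa).
Proof.
have [phi [eta [mphi phiI phifix eta0 phieta]]] := ex_fixed_profile.
have phib t : phi t <= trunc_gtilde zeta2 + C * gsup by rewrite -phifix conv_bound.
have phi0 t : 0 <= phi t by rewrite -phifix conv_ge0.
have bz := conv_bound_lt.
exists phi; split; [split; [split|exact: phiI]|split; [|split; [split|]]].
- move=> t; apply/cvgrPdist_le => e e0.
  have [r r0 rP] := conv_op_equicontinuous mu K HK0 HKint trunc_g M
    measurable_trunc_g trunc_g_itv t e e0.
  apply: filterS (nbhsx_ballx t _ r0) => t'; rewrite -ball_normE /= distrC => tt'.
  by rewrite distrC -(phifix t) -(phifix t'); exact: rP.
(* Both weights are controlled by 0 <= phi <= phi^+ alone, as lambda/2 < lambda governs the left
   half-line and lambda + eps > lambda the right one. *)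
- exists delta => s; have /andP[_ sp] := phiI s; rewrite ger0_norm //.
  have decay (a x : R) : 0 <= (a - lambda) * x -> expR (- (a * x)) * pp x <= delta.
    move=> ax; rewrite /pp /phi_plus mulrCA -expRD -[leRHS]mulr1 ler_pM2l //.
    by rewrite -[leRHS]expR0 ler_expR; lra.
  have bound (a : R) : 0 <= (a - lambda) * s -> expR (- (a * s)) * phi s <= delta.
    by move=> as0; apply: le_trans (decay a s as0); rewrite ler_wpM2l ?expR_ge0.
  split=> s0; apply: bound.
    by rewrite mulr_le0 //; move: Hlam; lra.
  by rewrite mulr_ge0 //; move: Heps; lra.
- move=> t; rewrite -(phifix t).
  rewrite -(Aop_conv_op mu K HK0 HKint trunc_g M measurable_trunc_g trunc_g_itv) //.
  rewrite /Aop; apply: eq_integral => tau _; apply: eq_integral => s _.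
  by rewrite trunc_gE // phi0 (le_trans (phib _)) // ltW.
- by exists (trunc_gtilde zeta2 + C * gsup) => _ [t _ <-].
- apply: le_lt_trans bz; apply: ge_sup; first by exists (phi 0), 0.
  by move=> _ [t _ <-].
- by move=> kappa; exact: (profile_limit phi eta kappa).
Qed.

End Profile.


Theorem theorem4p2 (R : realType) (d : measure_display) (X : measurableType d)
  (mu : {finite_measure set X -> \bar R})
  (K : R -> X -> R) (g : R -> X -> R) (gp : X -> R)
  (tau0 : X) (zeta2 delta lambda eps : R) (omegabar : \bar R)
  (* standing assumptions on K *)
  (HK0 : forall s tau, 0 <= K s tau)
  (HKint : ((@lebesgue_measure R) \x mu)%E.-integrable setT
             (fun p : R * X => (K p.1 p.2)%:E))
  (HKpos : forall tau, (0 < Kmass K tau)%E)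
  (* standing assumptions on g; gp tau = g'(0,tau) *)
  (Hg0 : forall s tau, 0 <= s -> 0 <= g s tau)
  (Hgmeas : measurable_fun [set p : R * X | 0 <= p.1]
              (fun p : R * X => g p.1 p.2))
  (Hgzero : forall tau, g 0 tau = 0)
  (Hgcont : forall tau, {within `[0, +oo[%classic, continuous (fun v => g v tau)})
  (Hgder : forall tau, (fun h => g h tau / h) x @[x --> 0^'+] --> gp tau)
  (Hgp : forall tau, 0 < gp tau)
  (* condition (N) *)
  (HN_meas : measurable [set tau0])
  (HN_atom : mu [set tau0] = 1%E)
  (HN_mono : forall tau, tau <> tau0 ->
     {in `[0, +oo[ &, nondecreasing (fun v => g v tau)})
  (HN_pos0 : forall v, 0 < v -> 0 < g v tau0)
  (HN_zeta : 0 < zeta2)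
  (HN_Theta : {in `[0, zeta2] &, {mono Theta mu K g tau0 : u v / u < v}})
  (HN_bound : Theta mu K g tau0 zeta2 >
     fine (Kmass K tau0) * sup [set g v tau0 | v in `[0, +oo[%classic])
  (* chi(0) < 0 *)
  (Hchi0def : chi_defined mu K gp 0)
  (Hchi0 : chi mu K gp 0 < 0)
  (* sublinearity *)
  (Hsublin : forall s tau, 0 <= s -> g s tau <= gp tau * s)
  (* condition (L) with constant delta *)
  (HL_delta : 0 < delta)
  (HL_bdd : exists M : R, forall s tau, 0 <= s -> g s tau <= M)
  (HL_pos : forall s tau, 0 < s -> 0 < g s tau)
  (HL_lin : forall s tau, 0 <= s < delta -> g s tau = gp tau * s)
  (* chi is defined on (0, omegabar) and changes sign there *)
  (Homega : (0 < omegabar)%E)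
  (Hchidef : forall z, 0 < z -> (z%:E < omegabar)%E -> chi_defined mu K gp z)
  (Hsign : exists z1 z2, 0 < z1 /\ (z1%:E < omegabar)%E /\ 0 < z2 /\
             (z2%:E < omegabar)%E /\ chi mu K gp z1 * chi mu K gp z2 < 0)
  (* lambda = leftmost positive zero of chi *)
  (Hlam : 0 < lambda) (Hlamom : (lambda%:E < omegabar)%E)
  (Hlamzero : chi mu K gp lambda = 0)
  (Hlamleft : forall z, 0 < z < lambda -> chi mu K gp z <> 0)
  (* eps, nu = lambda + eps *)
  (Heps : 0 < eps)
  (Hnu : ((lambda + eps)%:E < omegabar)%E)
  (Hchinu : 0 < chi mu K gp (lambda + eps)) :
  exists phi : R -> R,
    frakK delta lambda eps (lambda + eps) phi /\
    (forall t, Aop mu K g phi t = (phi t)%:E) /\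
    ((exists l : R, (fun h => Gmap mu K g tau0 zeta2 h / h) x @[x --> 0^'+] --> l) ->
       has_ubound (range phi) /\ sup (range phi) < zeta2) /\
    (forall kappa : R,
       kappa <> 0 ->
       [set s | 0 <= s /\ Gmap mu K g tau0 zeta2 s = s] = [set 0; kappa] ->
       (forall s, 0 < s <= zeta2 ->
          iter n (Gmap mu K g tau0 zeta2) s @[n --> \oo] --> kappa) ->
       phi t @[t --> +oo] --> kappa).
Proof.
have [M HM] := HL_bdd.
have lamd := Hchidef _ Hlam Hlamom.
have nud := Hchidef _ (addr_gt0 Hlam Heps) Hnu.
have [phi [h1 [h2 [h3 h4]]]] := profile_exists R d X mu K g gp tau0 zeta2 delta lambda eps M
  HK0 HKint HKpos Hg0 Hgmeas Hgzero Hgcont Hgp HN_meas HN_atom HN_mono HN_pos0 HN_zeta HN_Theta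
  HN_bound Hchi0def Hchi0 Hsublin HL_delta HM HL_lin Hlam lamd Hlamzero Heps nud Hchinu.
by exists phi; split => //; split => //; split.
Qed.
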